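(* Let $(\Omega,\Sigma,\mu)$ be a measure space such that $L_1(\mu)$ has dimension greater than one and let $E$ be any non-zero (real or complex) Banach space. Then $\Phi_{L_1(\mu,E)}(\delta)=\Phi_{L_1(\mu,E)}^S(\delta)=\sqrt{2\delta}$ for every $\delta\in(0,1/2]$.
   Context: For a (real or complex) Banach space $X\neq\{0\}$, $B_X$ and $S_X$ denote its closed unit ball and unit sphere, $X^*$ its topological dual, and $\Pi(X):=\{(x,x^* )\in X\times X^* : \|x\|=\|x^*\|=x^*(x)=1\}$. The Bishop-Phelps-Bollobás modulus $\Phi_X:(0,2)\to[0,\infty)$ is defined as follows: $\Phi_X(\delta)$ is the infimum of those $\varepsilon>0$ such that for every $(x,x^* )\in B_X\times B_{X^*}$ with $\operatorname{Re} x^*(x)>1-\delta$ there is $(y,y^* )\in\Pi(X)$ with $\|x-y\|<\varepsilon$ and $\|x^*-y^*\|<\varepsilon$. The spherical Bishop-Phelps-Bollobás modulus $\Phi_X^S:(0,2)\to[0,\infty)$ is defined in the same way with $B_X\times B_{X^*}$ replaced by $S_X\times S_{X^*}$. $L_1(\mu,E)$ is the Banach space of (classes of) Bochner-integrable functions $f:\Omega\to E$ with norm $\int_\Omega\|f\|\,d\mu$, and $L_1(\mu)$ is the scalar-valued version. *)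

(* Defs.v *)
From HB Require Import structures.
From mathcomp Require Import all_boot all_order all_algebra.
From mathcomp Require Import complex generic_quotient ring_quotient.
From mathcomp Require Import all_classical all_reals all_analysis.
From mathcomp Require Import measurable_realfun.

Set Implicit Arguments.
Unset Strict Implicit.
Unset Printing Implicit Defensive.

Import Order.TTheory GRing.Theory Num.Theory.
Import numFieldNormedType.Exports.
Import HBNNSimple.

Local Open Scope classical_set_scope.
Local Open Scope ring_scope.
Local Open Scope quotient_scope.

Variant scalar_kind := RealScalars | ComplexScalars.

Definition scalar_field (R : realType) (k : scalar_kind) : numFieldType :=
  match k with RealScalars => R | ComplexScalars => R[i] end.

Definition reK {R : realType} {k : scalar_kind} : scalar_field R k -> R :=
  match k with RealScalars => id | ComplexScalars => @complex.Re R end.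

Definition ofR {R : realType} {k : scalar_kind} : R -> scalar_field R k :=
  match k with RealScalars => id | ComplexScalars => fun x => Complex x 0 end.

(* The library norm of a normed module over [R[i]] takes its values in [R[i]];
   [nrm] is the same norm as an element of [R]. *)
Definition nrm {R : realType} {k : scalar_kind}
    {V : normedModType (scalar_field R k)} (x : V) : R := reK `|x|.

Section scalars.
Variables (R : realType) (k : scalar_kind).
Implicit Types x y : R.
Local Notation K := (scalar_field R k).

Lemma ofRK x : reK (ofR x : K) = x.
Proof. by case: k. Qed.

Lemma ofRD x y : ofR (x + y) = ofR x + ofR y :> K.
Proof. by case: k => //; exact: (rmorphD (real_complex R)). Qed.

Lemma ofRM x y : ofR (x * y) = ofR x * ofR y :> K.
Proof. by case: k => //; exact: (rmorphM (real_complex R)). Qed.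

Lemma ofR0 : ofR 0 = 0 :> K.
Proof. by case: k. Qed.

Lemma ler_ofR x y : (ofR x <= ofR y :> K) = (x <= y).
Proof. by case: k => //=; exact: lecR. Qed.

Lemma ltr_ofR x y : (ofR x < ofR y :> K) = (x < y).
Proof. by case: k => //=; exact: ltcR. Qed.

Lemma ge0_reK (z : K) : 0 <= z -> ofR (reK z) = z.
Proof.
by case: k z => //= -[a b]; rewrite lecE/= => /andP[/eqP -> _].
Qed.

Variable V : normedModType K.
Implicit Types u v : V.

Lemma ofR_nrm u : ofR (nrm u) = `|u|.
Proof. exact: ge0_reK. Qed.

Lemma nrm_ge0 u : 0 <= nrm u.
Proof. by rewrite -ler_ofR ofR0 ofR_nrm. Qed.

Lemma nrmD u v : nrm (u + v) <= nrm u + nrm v.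
Proof. by rewrite -ler_ofR ofRD !ofR_nrm ler_normD. Qed.

Lemma nrmZ (a : K) u : nrm (a *: u) = reK `|a| * nrm u.
Proof.
apply: (can_inj ofRK); rewrite ofRM ofR_nrm normrZ ofR_nrm ge0_reK //.
Qed.

Lemma nrmN u : nrm (- u) = nrm u.
Proof. by rewrite /nrm normrN. Qed.

Lemma nrm0 : nrm (0 : V) = 0.
Proof. by rewrite /nrm normr0 -ofR0 ofRK. Qed.

Lemma nrm_eq0 u : nrm u = 0 -> u = 0.
Proof.
by move=> u0; apply/eqP; rewrite -normr_eq0 -ofR_nrm u0 ofR0.
Qed.

Lemma ler_nrm_dist u v : `|nrm u - nrm v| <= nrm (u - v).
Proof.
have h (x y : V) : nrm x - nrm y <= nrm (x - y).
  by rewrite lerBlDr -{1}(subrK y x) nrmD.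
rewrite ler_norml h andbT -(nrmN (u - v)) opprB lerNl opprB; exact: h.
Qed.

Lemma cvg_nrm (u : nat -> V) (l : V) :
  u @ \oo --> l -> (nrm \o u) @ \oo --> nrm l.
Proof.
move=> /cvgrPdist_lt ul; apply/cvgrPdist_lt => e e0.
have : 0 < ofR e :> K by rewrite -ofR0 ltr_ofR.
move=> /ul; apply: filterS => n; rewrite -ofR_nrm ltr_ofR.
by apply: le_lt_trans; exact: ler_nrm_dist.
Qed.

End scalars.

Section dual.
Variables (R : realType) (k : scalar_kind).
Local Notation K := (scalar_field R k).

Record dual (X : normedModType K) := Dual {
  dual_fun :> {linear X -> K^o};
  dual_continuous : continuous dual_fun }.

Definition dual_nrm (X : normedModType K) (f : X -> K^o) : R :=
  sup [set nrm (f x) | x in [set x : X | nrm x <= 1]].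

Definition duality_pairs (X : normedModType K) : set (X * dual X) :=
  [set p : X * dual X | [/\ nrm p.1 = 1, dual_nrm p.2 = 1 & p.2 p.1 = 1]].

Definition bpb_modulus_on (X : normedModType K) (A : set (X * dual X))
    (delta : R) : R :=
  inf [set eps : R | 0 < eps /\
    forall (x : X) (xs : dual X), A (x, xs) -> 1 - delta < reK (xs x) ->
    exists (y : X) (ys : dual X), [/\ duality_pairs (y, ys),
      nrm (x - y) < eps & dual_nrm (xs \- ys) < eps]].

Definition bpb_modulus (X : normedModType K) : R -> R :=
  bpb_modulus_on [set p : X * dual X | nrm p.1 <= 1 /\ dual_nrm p.2 <= 1].

Definition spherical_bpb_modulus (X : normedModType K) : R -> R :=
  bpb_modulus_on [set p : X * dual X | nrm p.1 = 1 /\ dual_nrm p.2 = 1].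

End dual.

Definition dim_gt1 (K : numFieldType) (V : lmodType K) : Prop :=
  exists f g : V, forall a b : K, a *: f + b *: g = 0 -> a = 0 /\ b = 0.

Section bochner.
Context {R : realType} {k : scalar_kind} {d : measure_display}
  {T : measurableType d}.
Variable mu : {measure set T -> \bar R}.
Local Notation K := (scalar_field R k).
Variable E : normedModType K.
Implicit Types (f g s t : T -> E).

Definition simple_integrable s := [/\ finite_set (range s),
  forall x, measurable (s @^-1` [set x]) &
  (mu [set w | s w != 0%R] < +oo)%E].

Definition strongly_measurable f := exists s_ : nat -> T -> E,
  (forall n, simple_integrable (s_ n)) /\
  {ae mu, forall w, s_ ^~ w @ \oo --> f w}.

(* [mu] is not assumed complete, so [nrm \o f] may be measurable only up to a
   null set; its integral is still the expected one by [ae_eq_ge0_integral]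
   and [strongly_measurable_nrm]. *)
Definition L1nrm f : \bar R := (\int[mu]_w (nrm (f w))%:E)%E.

Definition bochner_integrable f := strongly_measurable f /\
  exists s_ : nat -> T -> E, (forall n, simple_integrable (s_ n)) /\
    (fun n => L1nrm (f \- s_ n)) @ \oo --> 0%E.

Lemma ae_setC (N : set T) : measurable N -> mu N = 0%E ->
  {ae mu, forall w, (~` N) w}.
Proof. by move=> mN N0; exists N; split=> // w /= /contrapT. Qed.

Lemma ae_le_ge0_integral (F G : T -> \bar R) :
  (forall w, 0 <= F w)%E -> (forall w, 0 <= G w)%E ->
  {ae mu, forall w, (F w <= G w)%E} ->
  (\int[mu]_w F w <= \int[mu]_w G w)%E.
Proof.
move=> F0 G0 [N [mN N0 FGN]].
rewrite !ge0_integralTE//; apply: ge_ereal_sup => _ [h /= hF <-].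
have mNC : measurable (~` N) by exact: measurableC.
have pE w : proj_nnsfun h mNC w = h w * \1_(~` N) w by [].
apply: le_ereal_sup_tmp; exists (sintegral mu (proj_nnsfun h mNC)).
  exists (proj_nnsfun h mNC) => // w.
  rewrite pE indicE; case: (boolP (w \in ~` N)) => wN.
    rewrite mulr1; apply: (le_trans (hF w)); apply: contrapT => /FGN.
    by move: wN; rewrite inE.
  by rewrite mulr0.
rewrite -!integralT_nnsfun.
rewrite (@ge0_ae_eq_integral _ _ _ mu setT (EFin \o h)
  (EFin \o (proj_nnsfun h mNC)))//.
- exact/measurable_EFinP.
- exact/measurable_EFinP.
- by move=> w _ /=; rewrite lee_fin.
- by move=> w _; rewrite lee_fin; exact: fun_ge0.
- apply: (filterS _ (ae_setC mN N0)) => w wN _.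
  by rewrite -[RHS]/(_%:E) pE indicE mem_set//= mulr1.
Qed.

Lemma ae_eq_ge0_integral (F G : T -> \bar R) :
  (forall w, 0 <= F w)%E -> (forall w, 0 <= G w)%E ->
  {ae mu, forall w, F w = G w} ->
  (\int[mu]_w F w = \int[mu]_w G w)%E.
Proof.
move=> F0 G0 FG; apply/eqP; rewrite eq_le; apply/andP; split;
  apply: ae_le_ge0_integral => //; apply: filterS FG => w -> //.
Qed.

Lemma measurable_simple_preimage s (B : set E) :
  simple_integrable s -> measurable (s @^-1` B).
Proof.
move=> [fs ms _].
rewrite (_ : s @^-1` B = \bigcup_(x in range s `&` B) (s @^-1` [set x])).
  apply: fin_bigcup_measurable => [|x _]; last exact: ms.
  exact: finite_setIl.
apply/seteqP; split => [w Bw|w [x [_ Bx] /= ->]//].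
by exists (s w).
Qed.

Lemma simple_integrableD s t : simple_integrable s -> simple_integrable t ->
  simple_integrable (s \+ t).
Proof.
move=> ss st; have [fs ms sfin] := ss; have [ft mt tfin] := st; split.
- apply: (sub_finite_set (B := [set x.1 + x.2 | x in range s `*` range t])).
    by move=> _ [w _ <-]; exists (s w, t w).
  exact/finite_image/finite_setX.
- move=> z.
  rewrite (_ : _ @^-1` _ = \bigcup_(x in range s)
     (s @^-1` [set x] `&` t @^-1` [set z - x])).
    apply: fin_bigcup_measurable => // x _; exact: measurableI.
  apply/seteqP; split => [w /= <-|w [x _ [/= -> ->]]]; last by rewrite subrKC.
  by exists (s w) => //; split => //=; rewrite addrAC subrr add0r.
- have ms0 : measurable [set w | s w != 0].
    exact: (measurable_simple_preimage [set x | x != 0] ss).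
  have mt0 : measurable [set w | t w != 0].
    exact: (measurable_simple_preimage [set x | x != 0] st).
  apply: (@le_lt_trans _ _ (mu ([set w | s w != 0] `|` [set w | t w != 0]))).
    apply: le_measure; rewrite ?inE//.
    + pose B := [set x : E * E | x.1 + x.2 != 0].
      rewrite (_ : [set w | _] = \bigcup_(x in range s)
        (s @^-1` [set x] `&` t @^-1` [set y | x + y != 0])).
        apply: fin_bigcup_measurable => // x _; apply: measurableI => //.
        exact: measurable_simple_preimage.
      by apply/seteqP; split => [w /= w0|w [x _ [/= -> ]]//]; exists (s w).
    + exact: measurableU.
    + move=> w /= w0; apply: contrapT => /not_orP[].
      move=> /negP/negPn/eqP sw /negP/negPn/eqP tw.
      by move: w0; rewrite sw tw addr0 eqxx.
  by rewrite (le_lt_trans (measureU2 _ ms0 mt0))// lte_add_pinfty.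
Qed.

Lemma simple_integrableZ (a : K) s : simple_integrable s ->
  simple_integrable (a \*: s).
Proof.
move=> ss; have [fs ms sfin] := ss; split.
- apply: (sub_finite_set (B := [set a *: x | x in range s])).
    by move=> _ [w _ <-]; exists (s w).
  exact: finite_image.
- move=> z; exact: (measurable_simple_preimage [set x | a *: x = z] ss).
- apply: le_lt_trans sfin; apply: le_measure; rewrite ?inE.
  + exact: (measurable_simple_preimage [set x | a *: x != 0] ss).
  + exact: (measurable_simple_preimage [set x | x != 0] ss).
  + by move=> w /=; apply: contra => /eqP ->; rewrite scaler0.
Qed.

Lemma strongly_measurableD f g : strongly_measurable f ->
  strongly_measurable g -> strongly_measurable (f \+ g).
Proof.
move=> [s [ss sf]] [t [st tg]]; exists (fun n => s n \+ t n); split.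
  by move=> n; exact: simple_integrableD.
by apply: filterS2 sf tg => w sw tw; exact: cvgD.
Qed.

Lemma strongly_measurableZ (a : K) f : strongly_measurable f ->
  strongly_measurable (a \*: f).
Proof.
move=> [s [ss sf]]; exists (fun n => a \*: s n); split.
  by move=> n; exact: simple_integrableZ.
by apply: filterS sf => w sw; exact: cvgZr.
Qed.

Lemma simple_strongly_measurable s :
  simple_integrable s -> strongly_measurable s.
Proof.
move=> ss; exists (fun=> s); split=> //.
by apply: aeW => w; exact: cvg_cst.
Qed.

Lemma strongly_measurableB f g : strongly_measurable f ->
  strongly_measurable g -> strongly_measurable (f \- g).
Proof.
move=> mf mg; rewrite (_ : f \- g = f \+ (-1 : K) \*: g)%R.
  by apply: strongly_measurableD => //; exact: strongly_measurableZ.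
by apply/funext => w /=; rewrite scaleN1r.
Qed.

Lemma strongly_measurable_nrm f : strongly_measurable f ->
  exists F : T -> \bar R, [/\ measurable_fun setT F, (forall w, 0 <= F w)%E &
    {ae mu, forall w, (nrm (f w))%:E = F w}].
Proof.
move=> [s [ss [N [mN N0 sfN]]]].
have mNC : measurable (~` N) by exact: measurableC.
exists (fun w => (nrm (f w) * \1_(~` N) w)%:E); split.
- apply/measurable_EFinP.
  apply: (@measurable_fun_cvg _ _ _ _
    (fun n w => nrm (s n w) * \1_(~` N) w)) => [n|w _].
    apply: measurable_funM => //.
    move=> _ B mB; rewrite setTI.
    exact: (measurable_simple_preimage (nrm @^-1` B) (ss n)).
  rewrite indicE; case: (boolP (w \in ~` N)) => wN.
    rewrite mulr1; under eq_fun do rewrite mulr1.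
    apply: cvg_nrm; apply: contrapT => /sfN.
    by move: wN; rewrite inE.
  by rewrite mulr0; under eq_fun do rewrite mulr0; exact: cvg_cst.
- by move=> w; rewrite lee_fin mulr_ge0// nrm_ge0.
- apply: (filterS _ (ae_setC mN N0)) => w wN.
  by rewrite indicE mem_set//= mulr1.
Qed.

Lemma L1nrm_ge0 f : (0 <= L1nrm f)%E.
Proof. by apply: integral_ge0 => w _; rewrite lee_fin nrm_ge0. Qed.

Lemma L1nrmD f g : strongly_measurable f -> strongly_measurable g ->
  (L1nrm (f \+ g)%R <= L1nrm f + L1nrm g)%E.
Proof.
move=> /strongly_measurable_nrm[F [mF F0 fF]].
move=> /strongly_measurable_nrm[G [mG G0 gG]].
have n0 (h : T -> E) w : (0 <= (nrm (h w))%:E)%E by rewrite lee_fin nrm_ge0.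
rewrite /L1nrm (ae_eq_ge0_integral _ _ fF)// (ae_eq_ge0_integral _ _ gG)//.
rewrite -ge0_integralD//; apply: ae_le_ge0_integral => //.
  by move=> w; rewrite adde_ge0.
by apply: filterS2 fF gG => w <- <-; rewrite -EFinD lee_fin nrmD.
Qed.

Lemma L1nrmZ (a : K) f : strongly_measurable f ->
  (L1nrm (a \*: f)%R = (reK `|a|)%:E * L1nrm f)%E.
Proof.
move=> /strongly_measurable_nrm[F [mF F0 fF]].
have n0 (h : T -> E) w : (0 <= (nrm (h w))%:E)%E by rewrite lee_fin nrm_ge0.
have a0 : (0 <= (reK `|a|)%:E)%E.
  by rewrite lee_fin -(@ler_ofR _ k) ofR0 ge0_reK.
rewrite /L1nrm (ae_eq_ge0_integral _ _ fF)//.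
rewrite -ge0_integralZl//; apply: ae_eq_ge0_integral => //.
  by move=> w; rewrite mule_ge0.
by apply: filterS fF => w <-; rewrite -EFinM nrmZ.
Qed.

Lemma L1nrm_ae_eq f g : {ae mu, forall w, f w = g w} -> L1nrm f = L1nrm g.
Proof.
move=> fg; apply: ae_eq_ge0_integral.
- by move=> w; rewrite lee_fin nrm_ge0.
- by move=> w; rewrite lee_fin nrm_ge0.
- by apply: filterS fg => w ->.
Qed.

Lemma L1nrm_eq0 f : strongly_measurable f -> L1nrm f = 0%E ->
  {ae mu, forall w, f w = 0}.
Proof.
move=> /strongly_measurable_nrm[F [mF F0 fF]].
have n0 w : (0 <= (nrm (f w))%:E)%E by rewrite lee_fin nrm_ge0.
rewrite /L1nrm (ae_eq_ge0_integral _ _ fF)// => iF0.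
have /ae_eq_integral_abs : measurable_fun setT F by [].
move=> /(_ mu measurableT)[+ _].
under eq_integral do rewrite gee0_abs//.
move=> /(_ iF0) aF0; apply: filterS2 fF aF0 => w fw /(_ I).
by rewrite -fw => -[/nrm_eq0].
Qed.

Lemma simple_L1nrm_lty s : simple_integrable s -> (L1nrm s < +oo)%E.
Proof.
move=> ss; have [fs ms sfin] := ss.
have ms0 : measurable [set w | s w != 0].
  exact: (measurable_simple_preimage [set x | x != 0] ss).
have [M M0 sM] : exists2 M, 0 <= M & forall w, nrm (s w) <= M.
  have : finite_set [set nrm x | x in range s] by exact: finite_image.
  move=> /finite_seqP[l sl]; exists (\sum_(y <- l) `|y|).
    by apply: sumr_ge0.
  move=> w; have : nrm (s w) \in l.
    suff : [set` l] (nrm (s w)) by [].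
    by rewrite -sl; exists (s w).
  elim: l {sl} => // y l ih; rewrite inE big_cons => /orP[/eqP ->|/ih h].
    by rewrite (le_trans (ler_norm _))// lerDl sumr_ge0.
  by rewrite (le_trans h)// lerDr.
apply: (@le_lt_trans _ _ (\int[mu]_w (M%:E * (\1_[set w | s w != 0] w)%:E))%E).
  apply: ae_le_ge0_integral => [w|w|].
  - by rewrite lee_fin nrm_ge0.
  - by rewrite -EFinM lee_fin mulr_ge0.
  - apply: aeW => w; rewrite -EFinM lee_fin indicE.
    case: (boolP (w \in _)) => /=; rewrite ?mulr1 ?mulr0//.
    rewrite notin_setE/= => /negP/negPn/eqP ->; by rewrite nrm0.
rewrite ge0_integralZl ?lee_fin//; last first.
  by apply/measurable_EFinP; exact: measurable_indic.
rewrite integral_indic// setIT.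
by rewrite lte_mul_pinfty ?lee_fin.
Qed.

Lemma bochner_L1nrm_lty f : bochner_integrable f -> (L1nrm f < +oo)%E.
Proof.
move=> [mf [s [ss sf]]].
have : \forall n \near \oo, (L1nrm (f \- s n)%R < 1)%E.
  apply: (sf [set x | (x < 1)%E]).
  exact: (nbhs_open_ereal_lt (f := cst 1)).
move=> [n _ /(_ n (leqnn _)) /= fn].
rewrite (_ : f = (f \- s n) \+ s n); last by apply/funext => w /=; rewrite subrK.
apply: le_lt_trans (L1nrmD _ _) _.
- by apply: strongly_measurableB => //; exact: simple_strongly_measurable.
- exact: simple_strongly_measurable.
- by apply: lte_add_pinfty; [exact: lt_trans fn (ltry _)|exact: simple_L1nrm_lty].
Qed.

Lemma bochner_L1nrm_fin f : bochner_integrable f -> L1nrm f \is a fin_num.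
Proof.
by move=> /bochner_L1nrm_lty; rewrite ge0_fin_numE// L1nrm_ge0.
Qed.

Definition bochner : {pred T -> E} := [pred f | `[< bochner_integrable f >]].

Lemma bochner_submod_closed : submod_closed bochner.
Proof.
have s0 : simple_integrable (0 : T -> E).
  split.
  - apply: (sub_finite_set (B := [set 0])); last exact: finite_set1.
    by move=> _ [w _ <-].
  - move=> x; have [->|x0] := eqVneq x 0.
      by rewrite (_ : _ @^-1` _ = setT)//; apply/seteqP; split.
    rewrite (_ : _ @^-1` _ = set0)//; apply/seteqP; split => // w /= w0.
    by move: x0; rewrite -w0 eqxx.
  - rewrite (_ : [set w | _] = set0) ?measure0 ?ltry//.
    by apply/seteqP; split => // w /=; rewrite eqxx.
split.
  apply/asboolP; split; first exact: simple_strongly_measurable.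
  exists (fun=> 0); split=> // .
  rewrite (_ : (fun _ => _) = cst 0%E); first exact: cvg_cst.
  apply/funext => n /=; rewrite /L1nrm integral0_eq// => w _ /=.
  by rewrite subr0 nrm0.
move=> a f g /asboolP[mf [s [ss sf]]] /asboolP[mg [t [st tg]]].
apply/asboolP; split.
  by apply: (strongly_measurableD (strongly_measurableZ a mf) mg).
exists (fun n => (a \*: s n) \+ t n); split.
  by move=> n; apply: simple_integrableD => //; exact: simple_integrableZ.
have h n : (0 <= L1nrm ((a *: f + g) \- ((a \*: s n) \+ t n))%R <=
  (reK `|a|)%:E * L1nrm (f \- s n)%R + L1nrm (g \- t n)%R)%E.
  rewrite L1nrm_ge0/=.
  have mfs : strongly_measurable (f \- s n).
    by apply: strongly_measurableB => //; exact: simple_strongly_measurable.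
  have mgt : strongly_measurable (g \- t n).
    by apply: strongly_measurableB => //; exact: simple_strongly_measurable.
  rewrite -L1nrmZ// (_ : _ \- _ = (a \*: (f \- s n)) \+ (g \- t n)).
    by apply: L1nrmD => //; exact: strongly_measurableZ.
  apply/funext => w /=; rewrite scalerBr opprD addrACA; congr (_ + _).
apply: (squeeze_cvge (f := cst 0%E) _ (cvg_cst _)).
  by apply: nearW h.
rewrite -[X in _ --> X]adde0 -[X in _ --> (X + _)%E](mule0 (reK `|a|)%:E).
by apply: cvgeD => //; exact: cvgeZl.
Qed.

HB.instance Definition _ :=
  GRing.isSubmodClosed.Build K (T -> E) bochner bochner_submod_closed.

Record bochner_fun := BochnerFun {
  bochner_val :> T -> E; bochner_valP : bochner_val \in bochner }.

HB.instance Definition _ := [isSub for bochner_val].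
HB.instance Definition _ := [Choice of bochner_fun by <:].
HB.instance Definition _ := [SubChoice_isSubLmodule of bochner_fun by <:].

Lemma bochner_funP (f : bochner_fun) : bochner_integrable f.
Proof. exact/asboolP/bochner_valP. Qed.

Lemma bochner_valD (f g : bochner_fun) w : (f + g) w = f w + g w.
Proof. by []. Qed.

Lemma bochner_valB (f g : bochner_fun) w : (f - g) w = f w - g w.
Proof. by []. Qed.

Lemma bochner_valZ (a : K) (f : bochner_fun) w : (a *: f) w = a *: f w.
Proof. by []. Qed.

Definition ae_null : {pred bochner_fun} :=
  [pred f : bochner_fun | `[< {ae mu, forall w, f w = 0} >]].

Lemma ae_null_zmod_closed : zmod_closed ae_null.
Proof.
split; first by apply/asboolP; apply: aeW.
move=> f g /asboolP f0 /asboolP g0; apply/asboolP.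
by apply: filterS2 f0 g0 => w fw gw; rewrite bochner_valB fw gw subr0.
Qed.

HB.instance Definition _ :=
  GRing.isZmodClosed.Build bochner_fun ae_null ae_null_zmod_closed.

Definition L1 : Type := Quotient.quot ae_null.

HB.instance Definition _ := GRing.Zmodule.on L1.
HB.instance Definition _ := EqQuotient.on L1.

Lemma L1_eqP (f g : bochner_fun) :
  \pi_L1 f = \pi_L1 g <-> {ae mu, forall w, f w = g w}.
Proof.
have -> : (\pi_L1 f = \pi_L1 g) <-> (f - g \in ae_null).
  by rewrite Quotient.idealrBE; split=> /eqP.
split=> [/asboolP|fg].
  by apply: filterS => w; rewrite bochner_valB => /eqP; rewrite subr_eq0 => /eqP.
by apply/asboolP; apply: filterS fg => w; rewrite bochner_valB => ->; rewrite subrr.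
Qed.

Lemma L1_repr (f : bochner_fun) :
  {ae mu, forall w, (repr (\pi_L1 f) : bochner_fun) w = f w}.
Proof. by apply/L1_eqP; rewrite reprK. Qed.

Definition L1_scale (a : K) (u : L1) : L1 := \pi_L1 (a *: (repr u : bochner_fun)).

Lemma L1_scale_pi (a : K) (f : bochner_fun) :
  L1_scale a (\pi_L1 f) = \pi_L1 (a *: f).
Proof.
apply/L1_eqP; apply: filterS (L1_repr f) => w.
by rewrite !bochner_valZ => ->.
Qed.

Lemma L1_ind (P : L1 -> Prop) : (forall f : bochner_fun, P (\pi_L1 f)) -> forall u, P u.
Proof. by move=> Pf u; rewrite -[u]reprK; exact: Pf. Qed.

Lemma L1_pi0 : \pi_L1 0 = 0.
Proof. exact: raddf0. Qed.

Lemma L1_piD (f g : bochner_fun) : \pi_L1 (f + g) = \pi_L1 f + \pi_L1 g.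
Proof. exact: raddfD. Qed.

Fact L1_scalerA a b u : L1_scale a (L1_scale b u) = L1_scale (a * b) u.
Proof. by elim/L1_ind: u => f; rewrite !L1_scale_pi scalerA. Qed.

Fact L1_scale1r : left_id 1 L1_scale.
Proof. by elim/L1_ind => f; rewrite L1_scale_pi scale1r. Qed.

Fact L1_scalerDr : right_distributive L1_scale +%R.
Proof.
move=> a; elim/L1_ind => f; elim/L1_ind => g.
by rewrite -L1_piD !L1_scale_pi scalerDr L1_piD.
Qed.

Fact L1_scalerDl u : {morph L1_scale^~ u : a b / a + b}.
Proof.
move=> a b; elim/L1_ind: u => f.
by rewrite !L1_scale_pi scalerDl L1_piD.
Qed.

HB.instance Definition _ := GRing.Zmodule_isLmodule.Build K L1
  L1_scalerA L1_scale1r L1_scalerDr L1_scalerDl.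

Lemma L1_piZ (a : K) (f : bochner_fun) : \pi_L1 (a *: f) = a *: \pi_L1 f.
Proof. by rewrite -L1_scale_pi. Qed.

(* Library norms take their values in the field of scalars; [L1_nrmE] gives the
   real-valued norm. *)
Definition L1_norm (u : L1) : K := ofR (fine (L1nrm (repr u : bochner_fun))).

Lemma L1_norm_pi (f : bochner_fun) : L1_norm (\pi_L1 f) = ofR (fine (L1nrm f)).
Proof. by rewrite /L1_norm (L1nrm_ae_eq (L1_repr f)). Qed.

Fact ler_L1_normD u v : L1_norm (u + v) <= L1_norm u + L1_norm v.
Proof.
elim/L1_ind: u => f; elim/L1_ind: v => g.
have [f1 g1] := (bochner_funP f, bochner_funP g).
rewrite -L1_piD !L1_norm_pi -ofRD ler_ofR -fineD ?bochner_L1nrm_fin//.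
apply: fine_le; last exact: (L1nrmD f1.1 g1.1).
  exact/bochner_L1nrm_fin/bochner_funP.
by rewrite fin_numD !bochner_L1nrm_fin.
Qed.

Fact L1_normZ (a : K) u : L1_norm (a *: u) = `|a| * L1_norm u.
Proof.
elim/L1_ind: u => f; have f1 := bochner_funP f.
rewrite -L1_piZ !L1_norm_pi (_ : L1nrm _ = L1nrm (a \*: (f : T -> E))%R)//.
rewrite (L1nrmZ a f1.1) fineM ?bochner_L1nrm_fin//= ofRM ge0_reK//.
Qed.

Fact L1_norm_eq0 u : L1_norm u = 0 -> u = 0.
Proof.
elim/L1_ind: u => f; have f1 := bochner_funP f.
rewrite L1_norm_pi -ofR0 => /(can_inj (@ofRK R k)) f0.
rewrite -L1_pi0; apply/L1_eqP.
apply: L1nrm_eq0 => //; first exact: f1.1.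
by rewrite -(fineK (bochner_L1nrm_fin f1)) f0.
Qed.

HB.instance Definition _ := Lmodule_isNormed.Build K L1
  ler_L1_normD L1_normZ L1_norm_eq0.

Lemma L1_nrmE (f : bochner_fun) :
  ((nrm (\pi_L1 f))%:E = \int[mu]_w (nrm (f w))%:E)%E.
Proof.
rewrite /nrm [`|_|]L1_norm_pi ofRK fineK//.
exact/bochner_L1nrm_fin/bochner_funP.
Qed.

End bochner.

(* Main.v *)
Require Import Defs.
From HB Require Import structures.
From mathcomp Require Import all_boot all_order all_algebra.
From mathcomp Require Import complex generic_quotient ring_quotient lra ring.
From mathcomp Require Import all_classical all_reals all_analysis.
From mathcomp Require Import measurable_realfun.
Import Order.TTheory GRing.Theory Num.Theory.
Import numFieldNormedType.Exports.

(** Upper bound, valid in every Banach space: let [s = sqrt (2 delta)],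
[t = |x'|] and [c = (s - (1 - t)) / 2].  Ekeland's principle on the unit ball
gives [y] with [|x - y| <= (t - 1 + delta) / c <= s] such that
[Re x'(w - y) <= c |w - y|] on the ball; by Hahn-Banach a functional of norm at
most [c] can be subtracted from [x'] so that the difference attains its norm at
[y].  Normalising this difference costs at most [c + (1 - t)] more, and
[2 c + (1 - t) = s].

Lower bound: two disjoint sets of finite positive measure split [L1 mu E] as
[Y (+)_1 Z] with [Y] and [Z] nonzero.  Take norming pairs [(u, u')] in [Y] and
[(v, v')] in [Z], and for [r < s] put [x = (r/2) u + (1 - r/2) v] and
[x' = (1 - r) u' + v'], so that [x'(x) = 1 - r^2/2 > 1 - delta].  If
[(y, y')] is a norm-attaining pair with [y] not in [Z], then [y'] has norm 1 on
[Y], hence [|x' - y'| >= r]; and if [y] is in [Z], then [|x - y| >= r].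

Completeness of [L1 mu E], needed for the upper bound, reduces to rapidly Cauchy
sequences of simple functions, which converge almost everywhere. *)

Set Implicit Arguments.
Unset Strict Implicit.
Unset Printing Implicit Defensive.
Local Open Scope classical_set_scope.
Local Open Scope ring_scope.
Local Open Scope quotient_scope.

(** * Uniform treatment of real and complex scalars *)

Section scalar_field_extra.
Variables (R : realType) (k : scalar_kind).
Local Notation K := (scalar_field R k).
Implicit Types (a : R) (z : K).

Lemma reKD z1 z2 : reK (z1 + z2) = reK z1 + reK z2 :> R.
Proof. by case: k z1 z2 => //= -[? ?] [? ?]. Qed.

Lemma reKN z : reK (- z) = - reK z :> R.
Proof. by case: k z => //= -[? ?]. Qed.

Lemma reKB z1 z2 : reK (z1 - z2) = reK z1 - reK z2 :> R.
Proof. by rewrite reKD reKN. Qed.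

Lemma reK_ofRM a z : reK (ofR a * z) = a * reK z :> R.
Proof. by case: k z => //= -[? ?]/=; rewrite mul0r subr0. Qed.

Lemma reK_le_norm z : reK z <= reK `|z| :> R.
Proof.
case: k z => /= [x|[x y]]; first exact: ler_norm.
change (x <= Num.sqrt (x ^+ 2 + y ^+ 2)).
rewrite (le_trans (ler_norm x))// -sqrtr_sqr ler_wsqrtr//.
by rewrite lerDl sqr_ge0.
Qed.

Lemma reK_norm_ge0 z : 0 <= reK `|z| :> R.
Proof. exact: (@nrm_ge0 R k K^o). Qed.

Lemma ofR1 : ofR 1 = 1 :> K.
Proof. by case: k. Qed.

Lemma ofRN a : ofR (- a) = - ofR a :> K.
Proof. by apply/eqP; rewrite -addr_eq0 -ofRD addNr ofR0. Qed.

Lemma norm_ofR a : 0 <= a -> `|ofR a : K| = ofR a.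
Proof. by move=> a0; rewrite ger0_norm// -ofR0 ler_ofR. Qed.

Lemma reK_norm_ofR a : reK `|ofR a : K| = `|a|.
Proof.
have [a0|a0] := leP 0 a; first by rewrite norm_ofR// ofRK ger0_norm.
have Na0 : 0 <= - a by rewrite oppr_ge0 ltW.
by rewrite -[ofR a]opprK normrN -ofRN norm_ofR// ofRK ltr0_norm.
Qed.

(** Rotating a vector by this phase makes a functional real and nonnegative there, so bounds on real
    parts become bounds on moduli. *)
Lemma unimodular_phase z : exists2 c : K,
  `|c| = 1 & c * z = ofR (reK `|z|).
Proof.
have [->|z0] := eqVneq z 0.
  by exists 1; rewrite ?normr1// mulr0 normr0 -ofR0 ofRK.
exists (`|z| / z); last by rewrite divfK// ge0_reK.
by rewrite normrM normfV normr_id divff// normr_eq0.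
Qed.

(** In the complex case [x = a] and [x ^+ 2 + y ^+ 2 <= a ^+ 2] leave no room for an imaginary
    part. *)
Lemma real_of_norm_le_re z a : reK `|z| <= a -> reK z = a -> z = ofR a.
Proof.
case: k z => //= -[x y]; change
  (Num.sqrt (x ^+ 2 + y ^+ 2) <= a -> x = a -> Complex x y = Complex a 0).
move=> + xa; rewrite {}xa => le.
have a0 : 0 <= a by rewrite (le_trans (sqrtr_ge0 _) le).
have : a ^+ 2 + y ^+ 2 <= a ^+ 2.
  rewrite -[leLHS]sqr_sqrtr; last by rewrite addr_ge0// sqr_ge0.
  by rewrite lerXn2r// nnegrE// sqrtr_ge0.
rewrite gerDl => y0; have /eqP : y ^+ 2 == 0 by rewrite eq_le y0 sqr_ge0.
by move=> /eqP; rewrite sqrf_eq0 => /eqP ->.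
Qed.

End scalar_field_extra.

(** * Hahn-Banach theorem with lower constraints along a convex cone *)

Section hahn_banach.
Variables (R : realType) (k : scalar_kind).
Local Notation K := (scalar_field R k).
Variable V : lmodType K.
Implicit Types (u v : V) (p q g : V -> R) (W : set (V * R)).

(** Only one inequality of positive homogeneity is required; the other follows by scaling with the
    inverse. *)
Definition sublinear p := (forall u v, p (u + v) <= p u + p v) /\
  (forall a u, 0 <= a -> p (ofR a *: u) <= a * p u).

(** A pair [z] in [W] stands for the constraint [z.2 <= g z.1] on a functional [g] to be found. *)
Definition convex_cone W := [/\ W (0, 0),
  forall z z', W z -> W z' -> W (z.1 + z'.1, z.2 + z'.2) &
  forall a z, 0 <= a -> W z -> W (ofR a *: z.1, a * z.2)].

Lemma sublinear0 p : sublinear p -> p 0 = 0.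
Proof.
move=> [pD pZ]; apply/eqP; rewrite eq_le; apply/andP; split.
  by have := pZ 0 0 (lexx _); rewrite scaler0 mul0r.
by have := pD 0 0; rewrite addr0; lra.
Qed.

Lemma sublinearN p u : sublinear p -> - p (- u) <= p u.
Proof.
by move=> sp; have := sp.1 u (- u); rewrite subrr sublinear0//; lra.
Qed.

Section cone_inf.
Variables (p : V -> R) (W : set (V * R)).
Hypotheses (sp : sublinear p) (cW : convex_cone W).
Hypothesis Wp : forall z, W z -> z.2 <= p z.1.

(** Any additive [g] below [p] that meets the constraints in [W] satisfies
    [g u <= p (u + z.1) - z.2], hence lies below this infimum. *)
Definition cone_inf u := inf [set p (u + z.1) - z.2 | z in W].

Let cone_inf_le u z : W z -> cone_inf u <= p (u + z.1) - z.2.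
Proof.
move=> Wz; apply: ge_inf; last by exists z.
(* Subadditivity and [Wp] bound the set from below, so the infimum is a genuine one. *)
exists (- p (- u)) => _ [y Wy <-].
have := sp.1 (u + y.1) (- u); rewrite addrAC subrr add0r.
by have := Wp Wy; lra.
Qed.

Let le_cone_inf u c : (forall z, W z -> c <= p (u + z.1) - z.2) ->
  c <= cone_inf u.
Proof.
move=> h; apply: lb_le_inf => [|_ [z Wz <-]]; last exact: h.
by exists (p (u + 0) - 0), (0, 0) => //; case: cW.
Qed.

Lemma cone_inf_le_sublinear u : cone_inf u <= p u.
Proof. by case: cW => /(cone_inf_le u); rewrite addr0 subr0. Qed.

Lemma cone_inf_oppr z : W z -> cone_inf (- z.1) <= - z.2.
Proof.
by move=> /(cone_inf_le (- z.1)); rewrite addNr sublinear0// sub0r.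
Qed.

Lemma sublinear_cone_inf : sublinear cone_inf.
Proof.
have [W0 WD WZ] := cW; split => [u v|a u].
  rewrite -lerBlDr; apply: le_cone_inf => z Wz; rewrite lerBlDr -lerBlDl.
  apply: le_cone_inf => z' Wz'; rewrite lerBlDl.
  apply: (le_trans (cone_inf_le _ (WD _ _ Wz Wz'))) => /=.
  by have := sp.1 (u + z.1) (v + z'.1); rewrite addrACA; lra.
rewrite le_eqVlt => /predU1P[<-|a0].
  by rewrite mul0r ofR0 scale0r (le_trans (cone_inf_le_sublinear _))// sublinear0.
rewrite mulrC -ler_pdivrMr//; apply: le_cone_inf => z Wz; rewrite ler_pdivrMr//.
apply: (le_trans (cone_inf_le _ (WZ _ _ (ltW a0) Wz))) => /=.
by have := sp.2 a (u + z.1) (ltW a0); rewrite -scalerDr; lra.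
Qed.

End cone_inf.

(* Among the sublinear functionals below [p], a minimal one is additive: for a
   sublinear [q] and a vector [v], [u |-> inf_t q (u + t v) - t q v] is
   sublinear and below [q]. *)
Lemma sublinear_minorant p : sublinear p -> exists g, [/\ sublinear g,
  forall u, g u <= p u & forall u v, g (u + v) = g u + g v].
Proof.
move=> sp; pose T := {q : V -> R | sublinear q /\ forall u, q u <= p u}.
have t0 : T by exists p.
pose r (s t : T) := `[< forall u, sval t u <= sval s u >].
(* The preorder [r] is reversed: a maximal element for [r] is a minimal sublinear functional. *)
have [||A Atot|g gmin] := @ZL_preorder T t0 r.
- by move=> t; apply/asboolP.
- move=> s t q /asboolP st /asboolP tq; apply/asboolP => u.
  exact: le_trans (tq u) (st u).
- have [[s0 As0]|A0] := pselect (exists s, A s); last first.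
    by exists t0 => s As; case: A0; exists s.
  pose q u := inf [set sval s u | s in A].
  have q_le s u : A s -> q u <= sval s u.
    move=> As; apply: ge_inf; last by exists s.
    exists (- p (- u)) => _ [t _ <-]; have [st tp] := svalP t.
    by have := sublinearN u st; have := tp (- u); lra.
  have le_q u c : (forall s, A s -> c <= sval s u) -> c <= q u.
    move=> h; apply: lb_le_inf => [|_ [s As <-]]; last exact: h.
    by exists (sval s0 u), s0.
  have sq : sublinear q.
    split => [u v|a u].
      rewrite -lerBlDr; apply: (le_q) => s As; rewrite lerBlDr -lerBlDl.
      apply: (le_q) => t At; rewrite lerBlDl.
      (* Two members of the chain are comparable; the smaller one serves for both arguments. *)
      have [/asboolP st|/asboolP ts] := Atot _ _ As At.
        apply: (le_trans (q_le t _ At)).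
        apply: (le_trans ((svalP t).1.1 u v)).
        by rewrite lerD2r.
      apply: (le_trans (q_le s _ As)).
      apply: (le_trans ((svalP s).1.1 u v)).
      by rewrite lerD2l.
    rewrite le_eqVlt => /predU1P[<-|a0].
      rewrite mul0r ofR0 scale0r (le_trans (q_le _ _ As0))//.
      by rewrite sublinear0//; case: (svalP s0).
    rewrite mulrC -ler_pdivrMr//; apply: (le_q) => s As; rewrite ler_pdivrMr//.
    apply: (le_trans (q_le s _ As)); rewrite mulrC.
    by apply: (svalP s).1.2; exact: ltW.
  have qp u : q u <= p u by rewrite (le_trans (q_le s0 _ As0))// (svalP s0).2.
  by exists (exist _ q (conj sq qp)) => s As; apply/asboolP => u /=; exact: q_le.
case: g gmin => g [sg gp] gmin; exists g; split => // u v.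
apply/eqP; rewrite eq_le sg.1/=.
(* For the ray through [(v, g v)], [cone_inf g W] is sublinear and below [g], hence equal to [g] by
   minimality; the element [t = 1] then gives [g u <= g (u + v) - g v]. *)
pose W := [set z : V * R | exists2 t, 0 <= t & z = (ofR t *: v, t * g v)].
have cW : convex_cone W.
  split => [|_ _ [s s0 ->] [t t0' ->]|a _ a0 [t t0' ->]] /=.
  - by exists 0 => //; rewrite ofR0 scale0r mul0r.
  - by exists (s + t); rewrite ?addr_ge0// ofRD scalerDl mulrDl.
  - by exists (a * t); rewrite ?mulr_ge0// scalerA ofRM mulrA.
have g0 : g 0 = 0 by exact: sublinear0.
have Wg z : W z -> z.2 <= g z.1.
  move=> [t t0' ->] /=; move: t0'; rewrite le_eqVlt => /predU1P[<-|t_gt0].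
    by rewrite mul0r ofR0 scale0r g0.
  rewrite -ler_pdivlMl//; have ti0 : 0 <= t^-1 by rewrite invr_ge0 ltW.
  have := sg.2 t^-1 (ofR t *: v) ti0.
  by rewrite scalerA -ofRM mulVf ?gt_eqF// ofR1 scale1r.
have sc := sublinear_cone_inf sg cW Wg.
have cg := cone_inf_le_sublinear sg cW Wg.
have cp w : cone_inf g W w <= p w by rewrite (le_trans (cg w)).
have /asboolP/(_ u)/= gc := gmin (exist _ _ (conj sc cp)) (asboolT cg).
apply: (@le_trans _ _ (cone_inf g W u + g v)); first by rewrite lerD2r.
rewrite -lerBrDr.
have Wv : W (v, g v) by exists 1 => //; rewrite ofR1 scale1r mul1r.
apply: ge_inf; last by exists (v, g v).
exists (- g (- u)) => _ [y Wy <-].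
have := sg.1 (u + y.1) (- u); rewrite addrAC subrr add0r.
by have := Wg _ Wy; lra.
Qed.

(** An additive minorant [g] of [cone_inf p W] meets the constraints because [- g z.1 = g (- z.1) <=
    cone_inf p W (- z.1) <= - z.2]. *)
Lemma hahn_banach_cone p W : sublinear p -> convex_cone W ->
  (forall z, W z -> z.2 <= p z.1) ->
  exists g, [/\ forall u v, g (u + v) = g u + g v,
    forall a u, g (ofR a *: u) = a * g u,
    forall u, g u <= p u & forall z, W z -> z.2 <= g z.1].
Proof.
move=> sp cW Wp; have sc := sublinear_cone_inf sp cW Wp.
have [g [sg gc gD]] := sublinear_minorant sc.
have gN u : g (- u) = - g u.
  by apply/eqP; rewrite -addr_eq0 -gD addNr sublinear0.
have gZ0 a u : 0 <= a -> g (ofR a *: u) = a * g u.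
  move=> a0; apply/eqP; rewrite eq_le sg.2//=.
  by have := sg.2 a (- u) a0; rewrite scalerN !gN mulrN lerN2.
exists g; split => //.
- move=> a u; have [a0|a0] := leP 0 a; first exact: gZ0.
  rewrite -[a]opprK ofRN scaleNr gN gZ0 ?mulNr//.
  by rewrite oppr_ge0 ltW.
- by move=> u; rewrite (le_trans (gc u))// cone_inf_le_sublinear.
- move=> z Wz; rewrite -lerN2 -gN (le_trans (gc _))//.
  exact: cone_inf_oppr.
Qed.

(** Over the complex field the functional is [g u - i g (i u)]. *)
Lemma complexification g : (forall u v, g (u + v) = g u + g v) ->
  (forall a u, g (ofR a *: u) = a * g u) ->
  exists G : {linear V -> K^o}, forall u, reK (G u) = g u.
Proof.
case: k V g => /= U g gD gZ.
  have lg : linear (g : U -> R^o) by move=> a u v; rewrite gD gZ.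
  pose h := GRing.isLinear.Build R U R^o *:%R g lg.
  pose G : {linear U -> R^o} := HB.pack (g : U -> R^o) h.
  by exists G.
pose i : R[i] := Complex 0 1.
pose f (u : U) : R[i]^o := Complex (g u) (- g (i *: u)).
have lf : linear f.
  move=> [a b] u v; rewrite /f.
  have gC w : g (Complex a b *: w) = a * g w + b * g (i *: w).
    have -> : Complex a b = Complex a 0 + Complex b 0 * i.
      by apply/eqP; rewrite eq_complex/=; apply/andP; split; apply/eqP; ring.
    by rewrite scalerDl gD gZ -scalerA gZ.
  have gi : g (i *: (i *: u)) = - g u.
    have -> : i *: (i *: u) = Complex (-1) 0 *: u.
      rewrite scalerA; congr (_ *: _).
      by apply/eqP; rewrite eq_complex/=; apply/andP; split; apply/eqP; ring.
    by rewrite gZ mulN1r.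
  rewrite scalerDr scalerA (mulrC i) -scalerA !gD !gC gi.
  by apply/eqP; rewrite eq_complex/=; apply/andP; split; apply/eqP; ring.
pose h := GRing.isLinear.Build R[i] U R[i]^o *:%R f lf.
pose G : {linear U -> R[i]^o} := HB.pack f h.
by exists G.
Qed.

End hahn_banach.

(** * Real-valued norms, dual norms and continuity of functionals *)

Lemma near_expr_half_lt (R : realType) (e : R) : 0 < e ->
  \forall n \near \oo, 2^-1 ^+ n < e.
Proof.
move=> e0; have h : `|2^-1 : R| < 1 by rewrite ger0_norm//; lra.
have := cvg_geometric (1 : R) h => /cvgrPdist_lt /(_ _ e0).
apply: filterS => n; rewrite /geometric/= mul1r sub0r normrN ger0_norm//.
Qed.

Section normed_module_extra.
Variables (R : realType) (k : scalar_kind).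
Local Notation K := (scalar_field R k).
Variable X : normedModType K.
Implicit Types (x y w : X).

Lemma nrmB_sym x y : nrm (x - y) = nrm (y - x).
Proof. by rewrite -nrmN opprB. Qed.

Lemma nrmZ_ofR (a : R) x : 0 <= a -> nrm (ofR a *: x) = a * nrm x.
Proof. by move=> a0; rewrite nrmZ reK_norm_ofR ger0_norm. Qed.

Lemma nrm_normalize x : x != 0 -> nrm (ofR (nrm x)^-1 *: x) = 1.
Proof.
move=> x0; have nx : nrm x != 0 by apply: contra x0 => /eqP/nrm_eq0 ->.
by rewrite nrmZ_ofR ?mulVf// invr_ge0 nrm_ge0.
Qed.

Lemma nrm_cvgP (T : Type) (F : set_system T) (FF : Filter F) (u : T -> X) x :
  (forall e : R, 0 < e -> \forall t \near F, nrm (x - u t) < e) <->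
  u @ F --> x.
Proof.
split=> [ux|/cvgrPdist_lt ux e e0].
  apply/cvgrPdist_lt => e e0.
  have eE : e = ofR (reK e) by rewrite ge0_reK// ltW.
  have /ux : 0 < reK e by rewrite -(ltr_ofR k) -eE ofR0.
  by apply: filterS => t; rewrite -(ltr_ofR k) ofR_nrm -eE.
have : 0 < ofR e :> K by rewrite -ofR0 ltr_ofR.
by move=> /ux; apply: filterS => t; rewrite -ofR_nrm ltr_ofR.
Qed.

End normed_module_extra.

Section dual_extra.
Variables (R : realType) (k : scalar_kind).
Local Notation K := (scalar_field R k).
Variable X : normedModType K.
Implicit Types (x y w : X).

Lemma nrm_continuous : continuous (@nrm R k X).
Proof.
move=> x; apply/cvgrPdist_lt => e e0; have /nrm_cvgP/(_ e e0) : id @ x --> x by [].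
by apply: filterS => y; apply: le_lt_trans; exact: ler_nrm_dist.
Qed.

Lemma reK_continuous (f : X -> K^o) :
  continuous f -> continuous (fun x => reK (f x) : R).
Proof.
move=> fc x; apply/cvgrPdist_lt => e e0; have /nrm_cvgP/(_ e e0) := fc x.
apply: filterS => y; apply: le_lt_trans; rewrite -reKB ler_norml.
rewrite (reK_le_norm (f x - f y)) andbT lerNl -reKN.
by rewrite (le_trans (reK_le_norm _))// normrN.
Qed.

Lemma nrm_linear_le_reK (G : {linear X -> K^o}) (M : R) :
  (forall x, reK (G x) <= M * nrm x) -> forall x, nrm (G x) <= M * nrm x.
Proof.
move=> GM x; have [c c1 cG] := unimodular_phase (G x).
have cGx : c * G x = G (c *: x) by rewrite linearZ.
rewrite -[nrm (G x)](@ofRK R k) -cG cGx.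
by rewrite (le_trans (GM _))// nrmZ c1 -ofR1 ofRK mul1r.
Qed.

Lemma bounded_linear_dual (F : {linear X -> K^o}) (M : R) :
  (forall x, nrm (F x) <= M * nrm x) -> continuous F.
Proof.
move=> FM; apply/bounded_linear_continuous/linear_boundedP.
exists (ofR M); split; first by rewrite realE -ofR0 !ler_ofR -realE num_real.
move=> r Mr x; apply: (@le_trans _ _ (ofR M * `|x|)).
  by rewrite -!ofR_nrm -ofRM ler_ofR.
by rewrite ler_wpM2r// ltW.
Qed.

Lemma dual_bounded (f : dual X) :
  exists2 M : R, 0 <= M & forall x, nrm (f x) <= M * nrm x.
Proof.
have /linear_bounded_continuous/linear_boundedP := @dual_continuous _ _ _ f.
move=> /pinfty_ex_gt0[M M0 fM]; have ME := ge0_reK (ltW M0).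
exists (reK M); first by rewrite -(ler_ofR k) ME ofR0 ltW.
by move=> x; rewrite -(ler_ofR k) ofRM !ofR_nrm ME.
Qed.

Lemma dual_nrm_le (f : X -> K^o) (M : R) :
  (forall x, nrm x <= 1 -> nrm (f x) <= M) -> dual_nrm f <= M.
Proof.
move=> fM; apply: ge_sup; last by move=> _ [x x1 <-]; exact: fM.
by exists (nrm (f 0)), 0 => //=; rewrite nrm0.
Qed.

Lemma nrm_le_dual_nrm (f : dual X) x : nrm x <= 1 -> nrm (f x) <= dual_nrm f.
Proof.
move=> x1; have [M M0 fM] := dual_bounded f.
apply: ub_le_sup; last by exists x.
exists M => _ [y y1 <-]; rewrite (le_trans (fM _))//.
by rewrite -[leRHS]mulr1 ler_wpM2l.
Qed.

Lemma dual_nrm_ge0 (f : dual X) : 0 <= dual_nrm f.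
Proof.
by apply: le_trans (@nrm_le_dual_nrm f 0 _); rewrite ?nrm_ge0// nrm0.
Qed.

Lemma nrm_dual_apply (f : dual X) x : nrm (f x) <= dual_nrm f * nrm x.
Proof.
have [->|x0] := eqVneq x 0; first by rewrite linear0 !nrm0 mulr0.
have nx : 0 < nrm x.
  by rewrite lt_def nrm_ge0 andbT; apply: contra x0 => /eqP/nrm_eq0 ->.
rewrite -ler_pdivrMr// mulrC -nrmZ_ofR ?invr_ge0 ?nrm_ge0// -linearZ.
by apply: nrm_le_dual_nrm; rewrite nrm_normalize.
Qed.

Lemma dual_lincomb (f g : dual X) (a b : K) :
  exists h : dual X, forall x, h x = a * f x + b * g x.
Proof.
pose F x : K^o := a * f x + b * g x.
have lF : linear F.
  move=> c u v; rewrite /F.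
  have e (h : dual X) : h (c *: u + v) = c * h u + h v :> K by exact: linearP.
  rewrite !e; change (a * (c * f u + f v) + b * (c * g u + g v) =
    c * (a * f u + b * g u) + (a * f v + b * g v) :> K).
  by ring.
pose L := GRing.isLinear.Build K X K^o *:%R F lF.
pose G : {linear X -> K^o} := HB.pack F L.
have cG : continuous G.
  apply: (@bounded_linear_dual G (reK `|a| * dual_nrm f + reK `|b| * dual_nrm g)).
  move=> x; apply: (le_trans (@nrmD R k K^o _ _)).
  rewrite mulrDl -!mulrA lerD//.
    rewrite [leLHS](@nrmZ R k K^o a (f x)) ler_wpM2l ?reK_norm_ge0//.
    exact: nrm_dual_apply.
  rewrite [leLHS](@nrmZ R k K^o b (g x)) ler_wpM2l ?reK_norm_ge0//.
  exact: nrm_dual_apply.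
by exists (Dual cG).
Qed.

End dual_extra.

(** * Ekeland's variational principle *)

Section ekeland.
Variables (R : realType) (k : scalar_kind).
Local Notation K := (scalar_field R k).
Variable X : completeNormedModType K.
Implicit Types (x y w z : X).

Lemma geometric_cauchy_cvg (u : nat -> X) :
  (forall n m, (n <= m)%N -> nrm (u m - u n) <= 2^-1 ^+ n) ->
  exists l : X, u @ \oo --> l.
Proof.
move=> uC; suff : cvgn u by move=> ?; exists (limn u).
apply: cauchy_cvg; apply: cauchy_exP => e e0.
have eE : e = ofR (reK e) by rewrite ge0_reK// ltW.
have /near_expr_half_lt[N _ NE] : 0 < reK e by rewrite -(ltr_ofR k) -eE ofR0.
exists (u N), N => // n /= Nn; rewrite -ball_normE/= -ofR_nrm eE ltr_ofR.
by rewrite nrmB_sym (le_lt_trans (uC _ _ Nn))// NE/=.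
Qed.

(** Order [C] by letting [y] be above [x] when [c * nrm (y - x) <= f y - f x]. Climbing to almost
    the supremum of [f] at each step gives a Cauchy sequence, and its limit is a maximal point above
    [z]. *)
Lemma ekeland (C : set X) (f : X -> R) (c M : R) z :
  closed C -> continuous f -> (forall x, C x -> f x <= M) -> 0 < c -> C z ->
  exists y, [/\ C y, c * nrm (y - z) <= f y - f z &
    forall w, C w -> f w - f y <= c * nrm (w - y)].
Proof.
move=> clC fc fM c0 Cz.
pose S x := [set y | C y /\ c * nrm (y - x) <= f y - f x].
have Sxx x : C x -> S x x by move=> Cx; split=> //; rewrite !subrr nrm0 mulr0.
have St x y w : S x y -> S y w -> S x w.
  move=> [Cy xy] [Cw yw]; split=> //.
  rewrite -(subrKA y w) (le_trans (ler_wpM2l (ltW c0) (nrmD _ _)))// mulrDr.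
  lra.
have step n x : C x -> exists y, S x y /\
    forall w, S x w -> f w - f y <= c * 2^-1 ^+ n.
  move=> Cx; have e0 : 0 < c * 2^-1 ^+ n by rewrite mulr_gt0// exprn_gt0.
  have hS : has_sup (f @` S x).
    split; first by exists (f x), x => //; exact: Sxx.
    by exists M => _ [y [Cy _] <-]; exact: fM.
  have [_ [y Sy <-] ylt] := sup_adherent e0 hS.
  exists y; split => // w Sw; rewrite lerBlDr -lerBlDl.
  apply: le_trans (ltW ylt); rewrite lerD2r.
  by apply: ub_le_sup; [case: hS | exists w].
have nexP n (x : {x | C x}) : {y : {x | C x} | S (sval x) (sval y) /\
    forall w, S (sval x) w -> f w - f (sval y) <= c * 2^-1 ^+ n}.
  apply: cid; have [y [Sy yw]] := step n _ (svalP x).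
  by exists (exist _ y Sy.1).
pose v := fix v n := if n is m.+1 then sval (nexP m (v m)) else exist _ z Cz.
pose u n := sval (v n).
have uS n : S (u n) (u n.+1) by have [] := svalP (nexP n (v n)).
have uSf n w : S (u n) w -> f w - f (u n.+1) <= c * 2^-1 ^+ n.
  by have [_] := svalP (nexP n (v n)); apply.
have Cu n : C (u n) by exact: svalP (v n).
have uSS n m : (n <= m)%N -> S (u n) (u m).
  move=> /subnK <-; elim: (m - n)%N => [|i ih]; first by rewrite add0n; exact: Sxx.
  by apply: St ih _; rewrite addSn; exact: uS.
(* Points above [u n.+1] are also above [u n], so they gain at most [c * 2^-1 ^+ n] in [f], and the
   order turns this gain into a distance. *)
have Sn n w : S (u n.+1) w -> nrm (w - u n.+1) <= 2^-1 ^+ n.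
  move=> Sw; rewrite -(ler_pM2l c0) (le_trans Sw.2)// uSf//.
  exact: St (uS n) Sw.
have [l ul] := @geometric_cauchy_cvg (fun n => u n.+1) (fun n m nm =>
  Sn _ _ (uSS n.+1 m.+1 nm)).
have Cl : C l by apply: (closed_cvg C clC _ l ul); exact: nearW.
have ful : f (u n.+1) @[n --> \oo] --> f l by apply: cvg_comp ul (fc l).
have Sl n : S (u n) l.
  split=> //.
  have h1 : c * nrm (u m.+1 - u n) @[m --> \oo] --> c * nrm (l - u n).
    apply: cvgMr; apply: cvg_nrm; apply: cvgB => //; exact: cvg_cst.
  have h2 : f (u m.+1) - f (u n) @[m --> \oo] --> f l - f (u n).
    by apply: cvgB => //; exact: cvg_cst.
  apply: (ler_cvg_to h1 h2); exists n => // m /= nm.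
  by have [] := uSS n m.+1 (leqW nm).
exists l; split=> // [|w Cw]; first by have [] := Sl 0%N.
(* A violating [w] would be above [l], hence above every [u n]; both [w] and [l] are then within
   [2^-1 ^+ n] of [u n.+1], so they coincide. *)
rewrite leNgt; apply/negP => wl.
have Slw : S l w by split=> //; exact: ltW.
have wl0 : nrm (w - l) <= 0.
  rewrite leNgt; apply/negP => p.
  have [n _ /(_ n (leqnn _))/= ne] := near_expr_half_lt (divr_gt0 p (ltr0Sn R 1)).
  have h1 := Sn n l (Sl n.+1).
  have h2 := Sn n w (St _ _ _ (Sl n.+1) Slw).
  have := nrmD (w - u n.+1) (u n.+1 - l).
  by rewrite subrKA (nrmB_sym (u n.+1) l); move: ne; lra.
have /nrm_eq0/eqP : nrm (w - l) = 0.
  by apply/eqP; rewrite eq_le wl0 nrm_ge0.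
rewrite subr_eq0 => /eqP wE.
by move: wl; rewrite wE !subrr nrm0 mulr0 ltxx.
Qed.

End ekeland.

(** * The upper bound, in an arbitrary Banach space *)

Section bishop_phelps_bollobas.
Variables (R : realType) (k : scalar_kind).
Local Notation K := (scalar_field R k).

Lemma closed_unit_ball (X : normedModType K) : closed [set x : X | nrm x <= 1].
Proof.
rewrite (_ : [set x | _] = (@nrm R k X) @^-1` [set a | a <= 1])//.
apply: closed_comp; last exact: closed_le.
by move=> x _; exact: nrm_continuous.
Qed.

Lemma sublinear_scaled_nrm (X : normedModType K) (c : R) :
  0 <= c -> sublinear (fun x : X => c * nrm x).
Proof.
move=> c0; split=> [u v|a u a0]; first by rewrite -mulrDr ler_wpM2l// nrmD.
by rewrite nrmZ_ofR// mulrCA.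
Qed.

Variable X : completeNormedModType K.

(** The constraints in [W] say [f w - f y <= g (w - y)] for [w] in the ball, and Ekeland's
    inequality makes them compatible with [g <= c * nrm]. Then [f - g] is maximal over the ball at
    [y], and [h] is the functional with this real part. *)
Lemma bishop_phelps (x : X) (xs : dual X) (c : R) : 0 < c -> nrm x <= 1 ->
  exists (y : X) (h : dual X), [/\ nrm y <= 1,
    c * nrm (y - x) <= dual_nrm xs - reK (xs x),
    forall w, nrm (xs w - h w : K^o) <= c * nrm w &
    h y = ofR (dual_nrm h)].
Proof.
move=> c0 x1; pose f w : R := reK (xs w).
have fD u v : f (u + v) = f u + f v by rewrite /f linearD reKD.
have fZ a u : f (ofR a *: u) = a * f u by rewrite /f linearZ; exact: reK_ofRM.
have fc : continuous f by apply: reK_continuous; exact: dual_continuous.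
have fM w : nrm w <= 1 -> f w <= dual_nrm xs.
  by move=> /(nrm_le_dual_nrm xs); apply: le_trans; exact: reK_le_norm.
have [y [y1 yx ymax]] := ekeland (@closed_unit_ball X) fc fM c0 x1.
pose W := [set z : X * R | exists a w, [/\ 0 <= a, nrm w <= 1 &
  z = (ofR a *: (w - y), a * (f w - f y))]].
have cW : convex_cone W.
  split=> [|_ _ [a [u [a0 u1 ->]]] [b [v [b0 v1 ->]]]|b _ b0 [a [u [a0 u1 ->]]]] /=.
  - by exists 0, y; rewrite ofR0 scale0r mul0r.
  - have [ab0|ab] := eqVneq (a + b) 0.
      have [-> ->] : a = 0 /\ b = 0 by split; lra.
      by exists 0, y; rewrite ofR0 !scale0r !mul0r !addr0.
    have ab_gt0 : 0 < a + b by rewrite lt_def ab addr_ge0.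
    have ai : 0 <= a / (a + b) by rewrite divr_ge0// ltW.
    have bi : 0 <= b / (a + b) by rewrite divr_ge0// ltW.
    have ea : (a + b) * (a / (a + b)) = a by rewrite mulrC divfK.
    have eb : (a + b) * (b / (a + b)) = b by rewrite mulrC divfK.
    (* A sum of two multiples of [u - y] and [v - y] is a multiple of [w - y], where [w] is a convex
       combination of [u] and [v]. *)
    exists (a + b), (ofR (a / (a + b)) *: u + ofR (b / (a + b)) *: v).
    split; first exact: ltW.
      apply: (le_trans (nrmD _ _)); rewrite !nrmZ_ofR//.
      have -> : 1 = a / (a + b) + b / (a + b) by rewrite -mulrDl divff.
      by apply: lerD; rewrite -[leRHS]mulr1 ler_wpM2l.
    rewrite [in RHS]scalerBr [in RHS]scalerDr !scalerA -!ofRM ea eb fD !fZ; congr pair.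
      by rewrite ofRD scalerDl !scalerBr opprD addrACA.
    rewrite [in RHS]mulrBr [in RHS]mulrDr (mulrA _ _ (f u)) (mulrA _ _ (f v)).
    by rewrite ea eb; ring.
  - by exists (b * a), u; rewrite mulr_ge0// ofRM scalerA mulrA.
have Wp z : W z -> z.2 <= c * nrm z.1.
  move=> [a [w [a0 w1 ->]]] /=.
  by rewrite nrmZ_ofR// mulrCA ler_wpM2l// ymax.
have [g [gD gZ gp Wg]] := hahn_banach_cone (sublinear_scaled_nrm X (ltW c0)) cW Wp.
have [G GE] := complexification gD gZ.
have Gc : forall w, nrm (G w) <= c * nrm w.
  by apply: nrm_linear_le_reK => w; rewrite GE; exact: gp.
have [h hE] := dual_lincomb xs (Dual (bounded_linear_dual Gc)) 1 (-1).
have {}hE w : h w = xs w - G w by rewrite hE mul1r mulN1r.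
have hmax w : nrm w <= 1 -> reK (h w) <= reK (h y) :> R.
  move=> w1; rewrite !hE !reKB !GE -/(f w) -/(f y).
  have /Wg/= : W (w - y, f w - f y).
    by exists 1, w; rewrite ofR1 scale1r mul1r.
  by have := gZ (-1) y; rewrite gD ofRN ofR1 scaleN1r mulN1r; lra.
have hle w : nrm w <= 1 -> nrm (h w) <= reK (h y) :> R.
  move=> w1; have [e e1 eh] := unimodular_phase (h w).
  have -> : nrm (h w) = reK (h (e *: w)) :> R.
    have -> : h (e *: w) = e * h w by rewrite linearZ.
    by rewrite eh ofRK.
  by apply: hmax; rewrite nrmZ e1 -(ofR1 R) ofRK mul1r.
have hy : reK (h y) = dual_nrm h :> R.
  apply/eqP; rewrite eq_le dual_nrm_le// andbT.
  by rewrite (le_trans (reK_le_norm _))// nrm_le_dual_nrm.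
exists y, h; split=> //.
- by rewrite (le_trans yx)// lerD2r fM.
- by move=> w; rewrite hE opprB addrC subrK.
- by apply: real_of_norm_le_re => //; exact: nrm_le_dual_nrm.
Qed.

Theorem bpb_sqrt (delta : R) (x : X) (xs : dual X) : 0 < delta ->
  delta <= 2^-1 -> nrm x <= 1 -> dual_nrm xs <= 1 -> 1 - delta < reK (xs x) ->
  exists (y : X) (ys : dual X), [/\ duality_pairs (y, ys),
    nrm (x - y) <= Num.sqrt (2 * delta) &
    dual_nrm (xs \- ys) <= Num.sqrt (2 * delta)].
Proof.
move=> d0 d2 x1 xs1 dxs; set s := Num.sqrt (2 * delta).
have s0 : 0 <= s by exact: sqrtr_ge0.
have ss : s ^+ 2 = 2 * delta by rewrite sqr_sqrtr//; lra.
have s1 : s <= 1 by rewrite leNgt; apply/negP => ?; nra.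
(* With [1 - t < delta] this makes the slope [c] below positive. *)
have ds : delta < s by rewrite ltNge; apply/negP => ?; nra.
set t := dual_nrm xs.
have td : 1 - delta < t.
  rewrite (lt_le_trans dxs)// (le_trans (reK_le_norm _))//.
  exact: nrm_le_dual_nrm.
pose c := (s - (1 - t)) / 2.
have c0 : 0 < c by rewrite divr_gt0//; lra.
have [y [h [y1 yx hxs hy]]] := bishop_phelps xs c0 x1.
set N := dual_nrm h in hy.
have tN : t <= N + c.
  apply: dual_nrm_le => w w1; have := nrm_le_dual_nrm h w1; rewrite -/N.
  have := hxs w; have := nrmD (xs w - h w : K^o) (h w); rewrite subrK.
  have : c * nrm w <= c by rewrite -[leRHS]mulr1 ler_wpM2l// ltW.
  lra.
have Nt : N <= t + c.
  apply: dual_nrm_le => w w1; have := nrm_le_dual_nrm xs w1; rewrite -/t.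
  have := hxs w; rewrite nrmB_sym; have := nrmD (h w - xs w : K^o) (xs w).
  rewrite subrK.
  have : c * nrm w <= c by rewrite -[leRHS]mulr1 ler_wpM2l// ltW.
  lra.
have N0 : 0 < N by rewrite /c in tN *; lra.
(* [ys] is [h] divided by its norm; the second coefficient is a dummy. *)
have [ys ysE] := dual_lincomb h h (ofR N^-1) 0.
have {}ysE w : ys w = ofR N^-1 * h w by rewrite ysE mul0r addr0.
have nysE w : nrm (ys w) = N^-1 * nrm (h w).
  by rewrite ysE; apply: nrmZ_ofR; rewrite invr_ge0 ltW.
(* From [N = nrm (h y) <= N * nrm y] and [0 < N]. *)
have yE : nrm y = 1.
  apply/eqP; rewrite eq_le y1/= -(ler_pM2l N0) mulr1.
  have := nrm_dual_apply h y; rewrite -/N hy.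
  by rewrite [nrm _]reK_norm_ofR gtr0_norm.
have ysy : ys y = 1 by rewrite ysE hy -ofRM mulVf ?gt_eqF// ofR1.
exists y, ys; split.
- split => //=; apply/eqP; rewrite eq_le; apply/andP; split.
    apply: dual_nrm_le => w w1; rewrite nysE mulrC ler_pdivrMr// mul1r.
    exact: nrm_le_dual_nrm.
  have := nrm_le_dual_nrm ys y1; rewrite ysy; apply: le_trans.
  by rewrite /nrm normr1 -(ofR1 R) ofRK.
- rewrite nrmB_sym -(ler_pM2l c0) (le_trans yx)// -/t.
  have t1 : 0 <= 1 - t by rewrite subr_ge0.
  (* Half of this product is the difference between [c * s] and the bound [t - 1 + delta] on
     [t - reK (xs x)]. *)
  have : 0 <= (1 - t) * (2 - s) by rewrite mulr_ge0//; lra.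
  have -> : c * s = delta - (1 - t) * s / 2.
    by rewrite /c -[delta](@mulKf _ 2)// -ss; field.
  lra.
- apply: dual_nrm_le => w w1 /=.
  (* The first term costs [c], and the normalisation costs [|N - 1| <= 1 - t + c]; together they
     give [s]. *)
  have -> : xs w - ys w = (xs w - h w) + ofR (1 - N^-1) * h w.
    by rewrite ysE ofRD ofR1 ofRN; ring.
  apply: (le_trans (@nrmD R k K^o _ _)).
  rewrite [X in _ + X](@nrmZ R k K^o).
  have h1 : reK `|ofR (1 - N^-1) : K| * nrm (h w) <= `|N - 1|.
    have -> : `|N - 1| = `|1 - N^-1| * N.
      by rewrite -{3}(gtr0_norm N0) -normrM mulrBl mul1r mulVf ?gt_eqF.
    by rewrite reK_norm_ofR ler_wpM2l// nrm_le_dual_nrm.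
  have h2 : `|N - 1| <= (1 - t) + c.
    have t1 : t <= 1 by [].
    by rewrite ler_norml; apply/andP; split; lra.
  have := hxs w.
  have : c * nrm w <= c by rewrite -[leRHS]mulr1 ler_wpM2l// ltW.
  have -> : s = c + (1 - t + c) by rewrite /c; lra.
  lra.
Qed.

End bishop_phelps_bollobas.

(** * The lower bound, in a space with a nontrivial L-projection *)

Section lower_bound.
Variables (R : realType) (k : scalar_kind).
Local Notation K := (scalar_field R k).
Variable X : normedModType K.

(** The cone is the ray through [(u, 1)]: it forces the real part at [u] to be at least 1, and
    domination by the norm gives equality. *)
Lemma norming_functional (u : X) : nrm u = 1 ->
  exists2 f : dual X, (forall x, nrm (f x) <= nrm x) & f u = 1.
Proof.
move=> u1; have sn := sublinear_scaled_nrm X (@ler01 R).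
pose W := [set z : X * R | exists2 a, 0 <= a & z = (ofR a *: u, a)].
have cW : convex_cone W.
  split=> [|_ _ [a a0 ->] [b b0 ->]|b _ b0 [a a0 ->]] /=.
  - by exists 0 => //; rewrite ofR0 scale0r.
  - by exists (a + b); rewrite ?addr_ge0// ofRD scalerDl.
  - by exists (b * a); rewrite ?mulr_ge0// ofRM scalerA.
have [|g [gD gZ gp Wg]] := hahn_banach_cone sn cW.
  by move=> _ [a a0 ->] /=; rewrite nrmZ_ofR// u1 mulr1 mul1r.
have [G GE] := complexification gD gZ.
have G1 : forall x, nrm (G x) <= 1 * nrm x.
  by apply: nrm_linear_le_reK => x; rewrite GE.
exists (Dual (bounded_linear_dual G1)) => /= [x|].
  by rewrite (le_trans (G1 x))// mul1r.
rewrite -(ofR1 R); apply: real_of_norm_le_re.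
  by have := G1 u; rewrite u1 mulr1.
apply/eqP; rewrite eq_le; apply/andP; split.
  by rewrite GE (le_trans (gp u))// u1 mulr1.
have /Wg/= : W (u, 1) by exists 1 => //; rewrite ofR1 scale1r.
by rewrite GE.
Qed.

Lemma dual_comp (f : dual X) (P : {linear X -> X}) :
  (forall x, nrm (P x) <= nrm x) -> exists h : dual X, forall x, h x = f (P x).
Proof.
move=> P1; have h : forall x, nrm ((f \o P) x) <= dual_nrm f * nrm x.
  move=> x; rewrite (le_trans (nrm_dual_apply _ _))// ler_wpM2l//.
  exact: dual_nrm_ge0.
by exists (Dual (bounded_linear_dual h)).
Qed.

(** This splits [X] as the l1-sum of the range and the kernel of [P]. *)
Definition L_projection (P : {linear X -> X}) :=
  (forall x, P (P x) = P x) /\ (forall x, nrm x = nrm (P x) + nrm (x - P x)).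

Lemma spherical_bpb_lower_bound (P : {linear X -> X}) (u v : X) (delta eps : R) :
  L_projection P -> u != 0 -> P u = u -> v != 0 -> P v = 0 ->
  delta <= 2^-1 -> 0 < eps ->
  (forall (x : X) (xs : dual X), nrm x = 1 -> dual_nrm xs = 1 ->
    1 - delta < reK (xs x) -> exists (y : X) (ys : dual X),
    [/\ duality_pairs (y, ys), nrm (x - y) < eps & dual_nrm (xs \- ys) < eps]) ->
  Num.sqrt (2 * delta) <= eps.
Proof.
move=> [PP PN] u0 Pu v0 Pv d2 eps0 H.
set s := Num.sqrt (2 * delta); rewrite leNgt; apply/negP => es.
pose u' := ofR (nrm u)^-1 *: u; pose v' := ofR (nrm v)^-1 *: v.
have u1 : nrm u' = 1 by exact: nrm_normalize.
have v1 : nrm v' = 1 by exact: nrm_normalize.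
have {}Pu : P u' = u' by rewrite linearZ/= Pu.
have {}Pv : P v' = 0 by rewrite linearZ/= Pv scaler0.
move: u' v' u1 v1 Pu Pv => {u0 v0}{}u {}v u1 v1 Pu Pv.
have P_le x : nrm (P x) <= nrm x by rewrite [leRHS]PN lerDl nrm_ge0.
have [f0 f0_le f0u] := norming_functional u1.
have [g0 g0_le g0v] := norming_functional v1.
have [f fE] := dual_comp f0 P_le.
have [g1 g1E] := dual_comp g0 P_le.
(* [f] vanishes on the kernel of [P] and [g] on its range, so they act on the two summands
   separately. *)
have [g gE] := dual_lincomb g0 g1 1 (-1).
have {}gE x : g x = g0 (x - P x) by rewrite gE g1E linearB mul1r mulN1r.
pose r := (eps + s) / 2.
have er : eps < r by rewrite /r; lra.
have rs : r < s by rewrite /r; lra.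
have d0 : 0 < delta.
  (* [Num.sqrt] is 0 on nonpositive reals, which contradicts [0 < eps < s]. *)
  rewrite ltNge; apply/negP => dle; suff : s = 0 by lra.
  by apply: ler0_sqrtr; lra.
have ss : s ^+ 2 = 2 * delta by rewrite sqr_sqrtr//; lra.
have s1 : s <= 1 by rewrite leNgt; apply/negP => ?; nra.
pose x0 := ofR (r / 2) *: u + ofR (1 - r / 2) *: v.
have [xs xsE] := dual_lincomb f g (ofR (1 - r)) 1.
have r2 : 0 <= r / 2 by lra.
have r2' : 0 <= 1 - r / 2 by lra.
have r1 : 0 <= 1 - r by lra.
have Px0 : P x0 = ofR (r / 2) *: u.
  by rewrite linearD !linearZ/= Pu Pv scaler0 addr0.
have x01 : nrm x0 = 1.
  rewrite PN Px0 addrAC subrr add0r !nrmZ_ofR// u1 v1; lra.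
have xsu : xs u = ofR (1 - r).
  by rewrite xsE fE gE Pu f0u subrr linear0 mulr1 mulr0 addr0.
have xsv : xs v = 1.
  by rewrite xsE fE gE Pv subr0 g0v linear0 mulr1 mulr0 add0r.
have fx x : nrm (ofR (1 - r) * f x : K^o) <= (1 - r) * nrm (P x).
  by rewrite [leLHS]nrmZ_ofR// ler_wpM2l// fE f0_le.
have xs1 : dual_nrm xs = 1.
  apply/eqP; rewrite eq_le; apply/andP; split.
    apply: dual_nrm_le => x x1; rewrite xsE mul1r.
    apply: (le_trans (@nrmD R k K^o _ _)).
    apply: (le_trans _ x1); rewrite [leRHS]PN; apply: lerD.
      rewrite (le_trans (fx x))// -[leRHS]mul1r ler_wpM2r ?nrm_ge0//; lra.
    by rewrite gE g0_le.
  have := @nrm_le_dual_nrm _ _ _ xs v; rewrite v1 xsv => /(_ (lexx _)).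
  by rewrite {1}/nrm normr1 -{1}(ofR1 R k) ofRK.
have xsx0 : 1 - delta < reK (xs x0).
  have -> : xs x0 = ofR (r / 2 * (1 - r) + (1 - r / 2)).
    have -> : xs x0 = ofR (r / 2) * xs u + ofR (1 - r / 2) * xs v :> K.
      by rewrite linearD !linearZ.
    by rewrite xsu xsv mulr1 [RHS]ofRD [in RHS]ofRM.
  (* The value is [1 - r ^+ 2 / 2], and [0 < r < s] with [s ^+ 2 = 2 * delta]. *)
  by rewrite ofRK; nra.
have [y [ys [[/= y1 ys1 ysy] xy xys]]] := H _ _ x01 xs1 xsx0.
have Py0 : nrm (P y) = 0.
  apply/eqP; rewrite eq_le nrm_ge0 andbT leNgt; apply/negP => Py.
  have [h hE] := dual_lincomb xs ys 1 (-1).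
  have hN : dual_nrm h < eps.
    rewrite (_ : (h : X -> K^o) = xs \- ys)//.
    by apply/funext => w; rewrite hE mul1r mulN1r.
  have h1 := nrm_dual_apply h (P y).
  (* As [ys y = 1] and the norms of [P y] and [y - P y] add up to 1, [ys] must attain its norm on
     each part. *)
  have h2 : nrm (P y) <= nrm (ys (P y)).
    have := nrm_dual_apply ys (y - P y); rewrite ys1 mul1r.
    have := @nrmD R k K^o (ys (P y)) (ys (y - P y)).
    rewrite -linearD addrC subrK ysy {1}/nrm normr1 -{1}(ofR1 R k) ofRK.
    by have := PN y; rewrite y1; lra.
  (* On the range of [P] the functional [xs] has norm at most [1 - r], so it differs from [ys] by at
     least [r > eps] there. *)
  have h3 : nrm (xs (P y)) <= (1 - r) * nrm (P y).
    rewrite xsE gE PP subrr linear0 mulr0 addr0.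
    by rewrite (le_trans (fx _))// PP.
  have h4 : nrm (ys (P y)) <= nrm (xs (P y)) + nrm (h (P y)).
    have -> : ys (P y) = xs (P y) - h (P y).
      by rewrite hE mul1r mulN1r opprB addrC subrK.
    by rewrite -(nrmN (h (P y))) nrmD.
  have : dual_nrm h * nrm (P y) < eps * nrm (P y) by rewrite ltr_pM2r.
  have : eps * nrm (P y) < r * nrm (P y) by rewrite ltr_pM2r.
  lra.
have {}Py0 : P y = 0 by exact: nrm_eq0.
(* With [y] in the kernel, the range part of [x0 - y] has norm [r / 2] and the kernel part at least
   [1 - (1 - r / 2)], in total at least [r]. *)
have := PN (x0 - y); rewrite linearB/= Px0 Py0 subr0 nrmZ_ofR// u1.
have -> : x0 - y - ofR (r / 2) *: u = ofR (1 - r / 2) *: v - y.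
  by rewrite addrAC [x0]addrC addrK.
have := ler_nrm_dist (ofR (1 - r / 2) *: v) y.
by rewrite nrmZ_ofR// v1 y1 ler_norml => /andP[]; lra.
Qed.

End lower_bound.

(** * Values of both moduli in the presence of an L-projection *)

Lemma inf_eq_threshold (R : realType) (S : set R) (s : R) :
  (forall e, S e -> s <= e) -> (forall e, s < e -> S e) -> inf S = s.
Proof.
move=> Ss sS; have S0 : S !=set0 by exists (s + 1); apply: sS; rewrite ltrDl.
apply/eqP; rewrite eq_le lb_le_inf// andbT.
apply/ler_addgt0Pr => e e0; apply: ge_inf; first by exists s.
by apply: sS; rewrite ltrDl.
Qed.

(** The sphere lies in the ball, so the spherical lower bound and the upper bound on the ball each
    serve both moduli. Whether the threshold itself is admissible stays open: the upper bound gives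
    [<=] while the moduli ask for [<]. *)
Theorem bpb_moduli_L_projection (R : realType) (k : scalar_kind)
    (X : completeNormedModType (scalar_field R k)) (P : {linear X -> X})
    (u v : X) (delta : R) :
  L_projection P -> u != 0 -> P u = u -> v != 0 -> P v = 0 ->
  0 < delta -> delta <= 2^-1 ->
  bpb_modulus X delta = Num.sqrt (2 * delta) /\
  spherical_bpb_modulus X delta = Num.sqrt (2 * delta).
Proof.
move=> LP u0 Pu v0 Pv d0 d2.
have s0 : 0 <= Num.sqrt (2 * delta) by exact: sqrtr_ge0.
split; apply: inf_eq_threshold => e.
- move=> [e0 H]; apply: (spherical_bpb_lower_bound LP u0 Pu v0 Pv d2 e0).
  by move=> x xs x1 xs1; apply: H; split => /=; rewrite ?x1 ?xs1.
- move=> se; split=> [|x xs [x1 xs1] dx]; first exact: le_lt_trans se.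
  have [y [ys [yys xy xys]]] := bpb_sqrt d0 d2 x1 xs1 dx.
  by exists y, ys; split => //; exact: le_lt_trans se.
- move=> [e0 H]; apply: (spherical_bpb_lower_bound LP u0 Pu v0 Pv d2 e0).
  by move=> x xs x1 xs1; apply: H; split => /=; rewrite ?x1 ?xs1.
- move=> se; split=> [|x xs [/= x1 xs1] dx]; first exact: le_lt_trans se.
  have x1' : nrm x <= 1 by rewrite x1.
  have xs1' : dual_nrm xs <= 1 by rewrite xs1.
  have [y [ys [yys xy xys]]] := bpb_sqrt d0 d2 x1' xs1' dx.
  by exists y, ys; split => //; exact: le_lt_trans se.
Qed.

(** * Approximation by simple functions and completeness of [L1 mu E] *)

Section l1.
Context {R : realType} {k : scalar_kind} {d : measure_display}
  {T : measurableType d}.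
Variable mu : {measure set T -> \bar R}.
Local Notation K := (scalar_field R k).
Variable E : normedModType K.

Lemma nrm_telescope (V : normedModType K) (x : nat -> V) (n m : nat) :
  (n <= m)%N -> nrm (x m - x n) <= \sum_(n <= i < m) nrm (x i.+1 - x i).
Proof.
move=> /subnK <-; elim: (m - n)%N => [|i ih].
  by rewrite add0n subrr nrm0 big_geq.
rewrite addSn big_nat_recr ?leq_addl//= -(subrKA (x (i + n)%N)).
by apply: (le_trans (nrmD _ _)); rewrite [leLHS]addrC lerD2r.
Qed.

Lemma nrm_pi_L1B (f g : bochner_fun mu E) :
  (nrm (\pi_(L1 mu E) f - \pi_(L1 mu E) g))%:E =
  L1nrm mu ((f : T -> E) \- g)%R.
Proof.
have -> : \pi_(L1 mu E) f - \pi_(L1 mu E) g = \pi_(L1 mu E) (f - g).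
  by rewrite raddfB.
by rewrite L1_nrmE.
Qed.

Lemma simple_bochner (s : T -> E) :
  simple_integrable mu s -> s \in bochner mu (E:=E).
Proof.
move=> ss; apply/asboolP; split; first exact: simple_strongly_measurable.
exists (fun=> s); split=> //.
rewrite (_ : (fun _ => _) = cst 0%E); first exact: cvg_cst.
apply/funext => i /=; rewrite /L1nrm integral0_eq// => w _ /=.
by rewrite subrr nrm0.
Qed.

Lemma L1_simple_approx (f : bochner_fun mu E) (e : R) : 0 < e ->
  exists s : bochner_fun mu E, simple_integrable mu (s : T -> E) /\
  nrm (\pi_(L1 mu E) f - \pi_(L1 mu E) s) < e.
Proof.
move=> e0; have [_ [s [ss sf]]] := bochner_funP f.
have : \forall n \near \oo, (L1nrm mu ((f : T -> E) \- s n)%R < e%:E)%E.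
  apply: (sf [set x | (x < e%:E)%E]).
  exact: (nbhs_open_ereal_lt (f := cst e)).
move=> [n _ /(_ n (leqnn _))/= fn].
by exists (BochnerFun (simple_bochner (ss n))); split; [exact: ss|rewrite -lte_fin nrm_pi_L1B].
Qed.

End l1.

Section l1_complete.
Context {R : realType} {k : scalar_kind} {d : measure_display}
  {T : measurableType d}.
Variable mu : {measure set T -> \bar R}.
Local Notation K := (scalar_field R k).
Variable E : completeNormedModType K.

Lemma summable_increments_cvg (x : nat -> E) (S : R) :
  (forall n, \sum_(0 <= i < n) nrm (x i.+1 - x i) <= S) ->
  exists l : E, x @ \oo --> l.
Proof.
move=> xS; pose a n := \sum_(0 <= i < n) nrm (x i.+1 - x i).
have acv : cvgn a.
  apply: nondecreasing_is_cvgn; last by exists S => _ [n _ <-]; exact: xS.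
  apply/nondecreasing_seqP => n; rewrite /a big_nat_recr//= lerDl.
  exact: nrm_ge0.
suff : cvgn x by move=> ?; exists (limn x).
apply: cauchy_cvg; apply: cauchy_exP => e e0.
have eE : e = ofR (reK e) by rewrite ge0_reK// ltW.
have e0' : 0 < reK e / 2 by rewrite divr_gt0// -(ltr_ofR k) -eE ofR0.
have /cvgrPdist_lt/(_ _ e0')[N _ NE] := acv.
exists (x N), N => // n /= Nn; rewrite -ball_normE/= -ofR_nrm eE ltr_ofR.
rewrite nrmB_sym (le_lt_trans (nrm_telescope x Nn))//.
have aE : \sum_(N <= i < n) nrm (x i.+1 - x i) = a n - a N.
  by rewrite /a (@big_cat_nat _ _ _ N 0 n)//= addrAC subrr add0r.
rewrite aE; have := NE n Nn; have := NE N (leqnn _) => /=.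
by rewrite !ltr_norml => /andP[? ?] /andP[? ?]; lra.
Qed.

Section rapidly_cauchy.
Variables (s : nat -> T -> E) (C : R).
Hypothesis ss : forall n, simple_integrable mu (s n).
Hypothesis C0 : 0 <= C.
Hypothesis sC : forall n,
  (L1nrm mu (s n.+1 \- s n)%R <= (C * 2^-1 ^+ n)%:E)%E.

Let g n w : \bar R := (nrm (s n.+1 w - s n w))%:E.

Let g0 n w : (0 <= g n w)%E. Proof. by rewrite lee_fin nrm_ge0. Qed.

Let mg n : measurable_fun setT (g n).
Proof.
apply/measurable_EFinP => _ B mB; rewrite setTI.
have sB : simple_integrable mu (s n.+1 \+ (-1 : K) \*: s n).
  by apply: simple_integrableD => //; exact: simple_integrableZ.
rewrite (_ : _ @^-1` B = (s n.+1 \+ (-1 : K) \*: s n) @^-1` (@nrm R k E @^-1` B)).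
  exact: (measurable_simple_preimage _ sB).
by apply/seteqP; split=> w /=; rewrite scaleN1r.
Qed.

Let integral_increments :
  (\int[mu]_w (\sum_(0 <= i <oo) g i w) <= (2 * C)%:E)%E.
Proof.
rewrite integral_nneseries//; apply: lime_le.
  by apply: is_cvg_nneseries => i _ _; exact: integral_ge0.
(* The right-hand side is the geometric sum of the bounds [C * 2^-1 ^+ i] for [i < n]. *)
apply: nearW => n; apply: (@le_trans _ _ (2 * C - 2 * C * 2^-1 ^+ n)%:E).
  elim: n => [|n ih]; first by rewrite big_geq// expr0 mulr1 subrr.
  rewrite big_nat_recr//= (le_trans (leeD ih (sC n)))// -EFinD lee_fin.
  by rewrite exprSr; lra.
by rewrite lee_fin gerBl mulr_ge0 ?exprn_ge0// mulr_ge0.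
Qed.

(** The sum of the increments has finite integral, so it is finite almost everywhere, and
    completeness of [E] applies at each such point. *)
Lemma rapidly_cauchy_ae_cvg :
  {ae mu, forall w, exists l : E, s ^~ w @ \oo --> l}.
Proof.
pose G w : \bar R := (\sum_(0 <= i <oo) g i w)%E.
have G0 w : (0 <= G w)%E by exact: nneseries_ge0.
have iG : mu.-integrable setT G.
  apply/integrableP; split.
    by apply: ge0_emeasurable_sum => // i w _ _; exact: g0.
  under eq_integral do rewrite gee0_abs//.
  exact: le_lt_trans integral_increments (ltry _).
apply: filterS (integrable_ae measurableT iG) => w /(_ I) Gw.
apply: (@summable_increments_cvg _ (fine (G w))) => n.
rewrite -lee_fin fineK// -sumEFin.
by apply: (@nneseries_lim_ge _ (g ^~ w) xpredT 0%N n) => i _ _; exact: g0.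
Qed.

Lemma rapidly_cauchy_limit_le (F : T -> E) :
  {ae mu, forall w, s ^~ w @ \oo --> F w} ->
  (L1nrm mu (F \- s 0%N)%R <= (2 * C)%:E)%E.
Proof.
move=> sF; apply: le_trans integral_increments.
apply: ae_le_ge0_integral => [w|w|]; first by rewrite lee_fin nrm_ge0.
  by apply: nneseries_ge0 => i _ _; exact: g0.
apply: filterS sF => w sw.
have h : nrm (s n w - s 0%N w) @[n --> \oo] --> nrm (F w - s 0%N w).
  by apply: cvg_nrm; apply: cvgB => //; exact: cvg_cst.
have : (\sum_(0 <= i <oo) g i w \is a fin_num)%E \/
    (\sum_(0 <= i <oo) g i w = +oo)%E.
  have : (0 <= \sum_(0 <= i <oo) g i w)%E.
    by apply: nneseries_ge0 => i _ _; exact: g0.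
  by case: (\sum_(0 <= i <oo) g i w)%E => [r||]//; [left|right].
move=> [fin|->]; last exact: leey.
rewrite -(fineK fin) lee_fin; apply: (cvgr_to_le h); apply: nearW => n.
rewrite (le_trans (nrm_telescope (s ^~ w) (leq0n n)))// -lee_fin fineK//.
rewrite -sumEFin.
by apply: (@nneseries_lim_ge _ (g ^~ w) xpredT 0%N n) => i _ _; exact: g0.
Qed.

End rapidly_cauchy.

Lemma rapidly_cauchy_limit (s : nat -> T -> E) (C : R) : 0 <= C ->
  (forall n, simple_integrable mu (s n)) ->
  (forall n, (L1nrm mu (s n.+1 \- s n)%R <= (C * 2^-1 ^+ n)%:E)%E) ->
  exists F : bochner_fun mu E, forall n,
    (L1nrm mu ((F : T -> E) \- s n)%R <= (2 * C * 2^-1 ^+ n)%:E)%E.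
Proof.
move=> C0 ss sC; have cs := rapidly_cauchy_ae_cvg ss C0 sC.
(* Where the sequence diverges [lim] is a default value; this happens only inside a null set. *)
pose F w : E := lim (s ^~ w @ \oo).
have sF : {ae mu, forall w, s ^~ w @ \oo --> F w}.
  by apply: filterS cs => w [l sl]; apply/cvg_ex; exists l.
have Fle n : (L1nrm mu (F \- s n)%R <= (2 * C * 2^-1 ^+ n)%:E)%E.
  rewrite -mulrA.
  (* The sequence started at index [n] is rapidly Cauchy with constant [C * 2^-1 ^+ n]. *)
  apply: (@rapidly_cauchy_limit_le (fun i => s (i + n)%N)) => [//||i|].
  - by rewrite mulr_ge0// exprn_ge0.
  - by rewrite -mulrA -exprD [(n + i)%N]addnC; exact: sC.
  - apply: filterS sF => w sw; rewrite (_ : (fun i => _) = (s ^~ w) \o (addn^~ n))//.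
    by rewrite cvg_shiftn.
have bF : F \in bochner mu (E:=E).
  apply/asboolP; split; first by exists s.
  exists s; split=> //.
  apply: (squeeze_cvge (f := cst 0%E)
    (h := fun n => (2 * C * 2^-1 ^+ n)%:E) _ (cvg_cst _)).
    by apply: nearW => n; rewrite L1nrm_ge0 Fle.
  apply: cvg_EFin; first exact: nearW.
  by apply: (@cvg_geometric R (2 * C) 2^-1); rewrite ger0_norm//; lra.
by exists (BochnerFun bF) => n; exact: Fle.
Qed.

Lemma L1_cauchy_cvg (F : set_system (L1 mu E)) :
  ProperFilter F -> cauchy F -> cvg F.
Proof.
move=> FF /cauchyP Fc.
have e0 n : 0 < 2^-1 ^+ n :> R by rewrite exprn_gt0.
have /choice[x Fx] : forall n, exists x : L1 mu E,
    F (ball x (ofR (2^-1 ^+ n))).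
  by move=> n; apply: Fc; rewrite -(ofR0 R) ltr_ofR.
have /choice[s sP] : forall n, exists s : bochner_fun mu E,
    simple_integrable mu (s : T -> E) /\
    nrm (x n - \pi_(L1 mu E) s) < 2^-1 ^+ n.
  by move=> n; rewrite -[x n]reprK; exact: L1_simple_approx.
have xx n : nrm (x n.+1 - x n) < 2^-1 ^+ n.+1 + 2^-1 ^+ n.
  have [y [/=]] := filter_ex (filterI (Fx n.+1) (Fx n)).
  rewrite -!ball_normE/= -!ofR_nrm !ltr_ofR => h1 h2.
  have := nrmD (x n.+1 - y) (y - x n); rewrite subrKA (nrmB_sym y); lra.
(* The constant 3 collects [2^-1 ^+ n.+1] and [2^-1 ^+ n], once each from [xx] and once each from
   the approximations by simple functions. *)
have ss n : (L1nrm mu ((s n.+1 : T -> E) \- s n)%R <= (3 * 2^-1 ^+ n)%:E)%E.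
  rewrite -nrm_pi_L1B lee_fin.
  have := nrmD (\pi_(L1 mu E) (s n.+1) - x n.+1) (x n.+1 - \pi_(L1 mu E) (s n)).
  have := nrmD (x n.+1 - x n) (x n - \pi_(L1 mu E) (s n)); rewrite !subrKA.
  rewrite (nrmB_sym (\pi_(L1 mu E) (s n.+1)) (x n.+1)).
  have := xx n; have [_] := sP n; have [_] := sP n.+1.
  by have := e0 n; rewrite exprSr; lra.
have [G GE] := rapidly_cauchy_limit (ler0n R 3) (fun n => (sP n).1) ss.
apply/cvg_ex; exists (\pi_(L1 mu E) G); apply/nrm_cvgP => e e_gt0.
(* From [G] to [s n] costs [6 * 2^-1 ^+ n]; passing on to [x n] and to [y] costs [2^-1 ^+ n]
   each. *)
have : 0 < e / 8 by rewrite divr_gt0.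
move=> /near_expr_half_lt[n _ /(_ n (leqnn _))/= ne].
apply: filterS (Fx n) => y; rewrite -ball_normE/= -ofR_nrm ltr_ofR => xy.
have := GE n; rewrite -nrm_pi_L1B lee_fin.
have := nrmD (\pi_(L1 mu E) G - \pi_(L1 mu E) (s n))
  (\pi_(L1 mu E) (s n) - y).
have := nrmD (\pi_(L1 mu E) (s n) - x n) (x n - y).
rewrite !subrKA (nrmB_sym _ (x n)); have [_] := sP n.
lra.
Qed.

HB.instance Definition _ := Uniform_isComplete.Build (L1 mu E) L1_cauchy_cvg.

End l1_complete.

(** * Restriction to a measurable set as an L-projection *)

Section restriction.
Context {R : realType} {k : scalar_kind} {d : measure_display}
  {T : measurableType d}.
Variable mu : {measure set T -> \bar R}.
Local Notation K := (scalar_field R k).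
Variable E : normedModType K.
Variable A : set T.
Hypothesis mA : measurable A.
Implicit Types (f s : T -> E).

Definition cutoff f w : E := if w \in A then f w else 0.

Lemma measurable_cutoff_preimage s (B : set E) :
  measurable (s @^-1` B) -> measurable (cutoff s @^-1` B).
Proof.
(* The complement of [A], where the function is 0, belongs to the preimage exactly when [B] contains
   0. *)
move=> mB; have [B0|B0] := pselect (B 0).
  rewrite (_ : _ @^-1` B = (A `&` s @^-1` B) `|` ~` A).
    by apply: measurableU; [exact: measurableI|exact: measurableC].
  apply/seteqP; split=> w; rewrite /cutoff /=; case: ifPn => wA.
  - by left; split=> //; rewrite -in_setE.
  - by right => Aw; move: wA; rewrite mem_set.
  - by case=> [[]//|nAw]; case: nAw; rewrite -in_setE.
  - by [].
rewrite (_ : _ @^-1` B = A `&` s @^-1` B); first exact: measurableI.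
apply/seteqP; split=> w; rewrite /cutoff /=; case: ifPn => wA //.
- by split=> //; rewrite -in_setE.
- by case.
- by case=> Aw; move: wA; rewrite mem_set.
Qed.

Lemma simple_integrable_cutoff s :
  simple_integrable mu s -> simple_integrable mu (cutoff s).
Proof.
move=> ss; have [fs _ sfin] := ss.
have mB (B : set E) : measurable (cutoff s @^-1` B).
  exact/measurable_cutoff_preimage/(measurable_simple_preimage _ ss).
split.
- apply: (sub_finite_set (B := 0 |` range s)).
    move=> _ [w _ <-]; rewrite /cutoff; case: ifP => _; [right|by left].
    by exists w.
  by rewrite finite_setU; split.
- by move=> x; exact: mB.
- apply: le_lt_trans sfin; apply: le_measure; rewrite ?inE.
  + exact: (mB [set x | x != 0]).
  + exact: (measurable_simple_preimage [set x | x != 0] ss).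
  + by move=> w /=; rewrite /cutoff; case: ifP => //; rewrite eqxx.
Qed.

Lemma simple_integrable_cutoff_cst (e : E) :
  (mu A < +oo)%E -> simple_integrable mu (cutoff (cst e)).
Proof.
move=> Aoo.
have mB (B : set E) : measurable (cutoff (cst e) @^-1` B).
  by apply: measurable_cutoff_preimage; rewrite preimage_cst; case: ifP.
split.
- apply: (sub_finite_set (B := [set 0; e])); last exact: finite_set2.
  by move=> _ [w _ <-]; rewrite /cutoff; case: ifP => _; [right|left].
- by move=> x; exact: mB.
- apply: le_lt_trans Aoo; apply: le_measure; rewrite ?inE//.
    exact: (mB [set x | x != 0]).
  by move=> w /=; rewrite /cutoff; case: ifPn => [|_]; rewrite ?inE// eqxx.
Qed.

Lemma strongly_measurable_cutoff f :
  strongly_measurable mu f -> strongly_measurable mu (cutoff f).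
Proof.
move=> [s [ss sf]]; exists (fun n => cutoff (s n)); split.
  by move=> n; exact: simple_integrable_cutoff.
apply: filterS sf => w sw; rewrite /cutoff; case: ifP => // _.
exact: cvg_cst.
Qed.

Lemma cutoff_bochner (f : bochner_fun mu E) : cutoff f \in bochner mu (E:=E).
Proof.
have [mf [s [ss sf]]] := bochner_funP f; apply/asboolP; split.
  exact: strongly_measurable_cutoff.
exists (fun n => cutoff (s n)); split; first by move=> n; exact: simple_integrable_cutoff.
apply: (squeeze_cvge (f := cst 0%E) _ (cvg_cst _) sf).
apply: nearW => n; rewrite L1nrm_ge0/=.
apply: ae_le_ge0_integral => [w|w|]; rewrite ?lee_fin ?nrm_ge0//.
apply: aeW => w; rewrite lee_fin /= /cutoff; case: ifP => // _.
by rewrite subrr nrm0 nrm_ge0.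
Qed.

(** At each point one of the two pieces vanishes; measurable representatives [F] and [G] of their
    norms allow the integral to be split. *)
Lemma L1nrm_cutoff f : strongly_measurable mu f ->
  L1nrm mu f = (L1nrm mu (cutoff f) + L1nrm mu (f \- cutoff f)%R)%E.
Proof.
move=> mf; have mAf := strongly_measurable_cutoff mf.
have [F [mF F0 fF]] := strongly_measurable_nrm mAf.
have [G [mG G0 gG]] := strongly_measurable_nrm (strongly_measurableB mf mAf).
have n0 (h : T -> E) w : (0 <= (nrm (h w))%:E)%E by rewrite lee_fin nrm_ge0.
rewrite /L1nrm (ae_eq_ge0_integral _ _ fF)// (ae_eq_ge0_integral _ _ gG)//.
rewrite -ge0_integralD//; apply: ae_eq_ge0_integral => //.
  by move=> w; rewrite adde_ge0.
apply: filterS2 fF gG => w <- <-; rewrite -EFinD /= /cutoff.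
by case: ifP => _; rewrite ?subrr ?subr0 nrm0 ?addr0 ?add0r.
Qed.

Definition L1_restr (u : L1 mu E) : L1 mu E :=
  \pi_(L1 mu E) (BochnerFun (cutoff_bochner (repr u))).

Lemma L1_restr_pi (f g : bochner_fun mu E) :
  {ae mu, forall w, g w = cutoff f w} ->
  L1_restr (\pi_(L1 mu E) f) = \pi_(L1 mu E) g.
Proof.
move=> fg; apply/L1_eqP; apply: filterS2 (L1_repr f) fg => w /= fw ->.
by rewrite /cutoff fw.
Qed.

Lemma L1_restr_linear : linear L1_restr.
Proof.
move=> a u v; rewrite -[u]reprK -[v]reprK; move: (repr u) (repr v) => f g.
rewrite -L1_piZ -L1_piD.
rewrite (@L1_restr_pi f (BochnerFun (cutoff_bochner f))); last exact: aeW.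
rewrite (@L1_restr_pi g (BochnerFun (cutoff_bochner g))); last exact: aeW.
rewrite -L1_piZ -L1_piD; apply: L1_restr_pi; apply: aeW => w.
rewrite bochner_valD bochner_valZ /= /cutoff; case: ifP => // _.
by rewrite scaler0 addr0.
Qed.

HB.instance Definition _ :=
  GRing.isLinear.Build K (L1 mu E) (L1 mu E) *:%R L1_restr L1_restr_linear.

Lemma L1_restr_L_projection : L_projection L1_restr.
Proof.
split=> u; rewrite -[u]reprK; move: (repr u) => f /=.
  rewrite (@L1_restr_pi f (BochnerFun (cutoff_bochner f))); last exact: aeW.
  apply: L1_restr_pi; apply: aeW => w /=.
  by rewrite /cutoff; case: ifP.
rewrite (@L1_restr_pi f (BochnerFun (cutoff_bochner f))); last exact: aeW.
have [mf _] := bochner_funP f.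
apply: EFin_inj; rewrite EFinD nrm_pi_L1B !L1_nrmE; exact: L1nrm_cutoff.
Qed.

End restriction.

(** * Two disjoint sets of finite positive measure from the dimension hypothesis *)

Section dimension.
Context {R : realType} {k : scalar_kind} {d : measure_display}
  {T : measurableType d}.
Variable mu : {measure set T -> \bar R}.
Local Notation K := (scalar_field R k).

Definition pos_fin_measure (A : set T) :=
  [/\ measurable A, (0 < mu A)%E & (mu A < +oo)%E].

Lemma not_pos_fin_measure_ae (A : set T) :
  measurable A -> (mu A < +oo)%E -> ~ pos_fin_measure A ->
  {ae mu, forall w, ~ A w}.
Proof.
move=> mA Aoo nA; apply: (ae_setC mA); apply/eqP.
rewrite eq_le measure_ge0 andbT leNgt; apply/negP => A0; exact: nA.
Qed.

Section no_disjoint_pair.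
Variable E : normedModType K.
Hypothesis no_pair : forall A B, pos_fin_measure A -> pos_fin_measure B ->
  A `&` B = set0 -> False.

(** Some level set of [s] inside [A] has positive measure, as finitely many of them cover [A]. What
    lies in [A] off this level set, and the part of the support outside [A], must be null, or else a
    disjoint pair appears. *)
Lemma simple_integrable_on_atom (A : set T) (s : T -> E) :
  pos_fin_measure A -> simple_integrable mu s ->
  exists c, {ae mu, forall w, s w = cutoff A (cst c) w}.
Proof.
move=> pA ss; have [mA A0 Aoo] := pA; have [fs ms sfin] := ss.
have mpre B : measurable (s @^-1` B) by exact: measurable_simple_preimage ss.
have sub_fin B : measurable B -> (mu (A `&` B) < +oo)%E.
  by move=> mB; apply: le_lt_trans Aoo; apply: le_measure; rewrite ?inE//;
    exact: measurableI.
have offA : {ae mu, forall w, ~ (s @^-1` [set x | x != 0] `\` A) w}.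
  apply: not_pos_fin_measure_ae; first exact: measurableD.
    apply: le_lt_trans sfin; apply: le_measure; rewrite ?inE//.
      exact: measurableD.
    exact: (mpre [set x | x != 0]).
  move=> pD; apply: (no_pair pA pD).
  by apply/seteqP; split=> // w [Aw [_ /(_ Aw)]].
have [c pc] : exists c, pos_fin_measure (A `&` s @^-1` [set c]).
  apply: contrapT => /forallNP npc; move: A0.
  have -> : A = \bigcup_(x in range s) (A `&` s @^-1` [set x]).
    apply/seteqP; split=> [w Aw|w [x _ []]//].
    by exists (s w).
  rewrite measure_fin_bigcup//=.
  - rewrite fsbig1 ?ltxx// => x _; apply/eqP.
    rewrite eq_le measure_ge0 andbT leNgt; apply/negP => px; apply: (npc x).
    by split=> //; [exact: measurableI|exact: sub_fin].
  - by move=> x y _ _ [w [[_ /= <-] [_ /= <-]]].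
  - by move=> x _; exact: measurableI.
have onA : {ae mu, forall w, ~ (A `&` s @^-1` [set x | x != c]) w}.
  apply: not_pos_fin_measure_ae; [exact: measurableI|exact: sub_fin|].
  move=> pD; apply: (no_pair pc pD).
  by apply/seteqP; split=> // w [[_ /= ->] [_ /=]]; rewrite eqxx.
exists c; apply: filterS2 offA onA => w noff non; rewrite /cutoff.
case: ifPn => wA; apply/eqP; apply: contrapT => /negP sw.
  by apply: non; split=> //; rewrite -in_setE.
by apply: noff; split=> // Aw; move: wA; rewrite mem_set.
Qed.

Lemma strongly_measurable_on_atom : exists A : set T,
  forall f : T -> E, strongly_measurable mu f ->
  exists c, {ae mu, forall w, f w = cutoff A (cst c) w}.
Proof.
have [A simpleA] : exists A : set T, forall s : T -> E,
    simple_integrable mu s ->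
    exists c, {ae mu, forall w, s w = cutoff A (cst c) w}.
  have [[A pA]|npA] := pselect (exists A, pos_fin_measure A).
    by exists A => s; exact: simple_integrable_on_atom.
  (* With no set of finite positive measure every simple integrable function vanishes almost
     everywhere. *)
  exists set0 => s ss; exists 0; have [_ _ sfin] := ss.
  have : {ae mu, forall w, ~ (s @^-1` [set x | x != 0]) w}.
    apply: not_pos_fin_measure_ae => //.
      exact: (measurable_simple_preimage _ ss).
    by move=> ps; apply: npA; exists (s @^-1` [set x | x != 0]).
  apply: filterS => w /= /negP/negPn/eqP ->.
  by rewrite /cutoff; case: ifP.
exists A => f [s [ss sf]].
have /choice[c cP] := fun n => simpleA _ (ss n).
have scf : {ae mu, forall w, (forall n, s n w = cutoff A (cst (c n)) w) /\
    s ^~ w @ \oo --> f w}.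
  by apply: filterS2 (ae_foralln cP) sf => w; split.
have off w : (forall n, s n w = cutoff A (cst (c n)) w) ->
    s ^~ w @ \oo --> f w -> w \notin A -> f w = 0.
  move=> sw swf wA; apply: (cvg_unique _ swf) => //.
  rewrite (_ : s ^~ w = cst 0); first exact: cvg_cst.
  by apply/funext => n; rewrite sw /cutoff (negbTE wA).
(* The approximants are constant on the good points of [A], so the limit at one such point [w0] is
   the limit at all of them; if there is none, any constant works. *)
have [[w0 [w0A [sw0 sf0]]]|nw0] := pselect (exists w0, w0 \in A /\
    ((forall n, s n w0 = cutoff A (cst (c n)) w0) /\
     s ^~ w0 @ \oo --> f w0)).
  exists (f w0); apply: filterS scf => w [sw swf]; rewrite /cutoff.
  case: ifPn => wA; last exact: off.
  apply: (cvg_unique _ swf) => //=.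
  rewrite (_ : s ^~ w = s ^~ w0)//; apply/funext => n.
  by rewrite sw sw0 /cutoff wA w0A.
exists 0; apply: filterS scf => w [sw swf]; rewrite /cutoff.
case: ifPn => wA; last exact: off.
by case: nw0; exists w.
Qed.

End no_disjoint_pair.

(** Otherwise all classes are multiples of one indicator: with values [a] and [b] of [f] and [g] on
    [A], the relation [b f - a g = 0] forces [a = 0], so [f] itself vanishes, against
    independence. *)
Lemma dim_gt1_disjoint_pair : dim_gt1 (L1 mu K^o) ->
  exists A B, [/\ pos_fin_measure A, pos_fin_measure B & A `&` B = set0].
Proof.
move=> [u [v uv]]; apply: contrapT => nAB.
have no_pair A B : pos_fin_measure A -> pos_fin_measure B ->
    A `&` B = set0 -> False by move=> pA pB AB; apply: nAB; exists A, B.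
have [A atom] := strongly_measurable_on_atom K^o no_pair.
move: uv; rewrite -[u]reprK -[v]reprK; move: (repr u) (repr v) => f g.
have [[/atom[a fa] _] [/atom[b gb] _]] := (bochner_funP f, bochner_funP g).
move=> uv; have [b0 a0] : b = 0 :> K /\ - a = 0 :> K.
  apply: uv; rewrite -!L1_piZ -L1_piD -L1_pi0; apply/L1_eqP.
  apply: filterS2 fa gb => w fw gw.
  rewrite bochner_valD !bochner_valZ fw gw /cutoff; case: ifP => _.
    by rewrite /GRing.scale/= mulrC mulNr subrr.
  by rewrite !scaler0 addr0.
have [] : (1 : K) = 0 /\ (0 : K) = 0; last by move/eqP; rewrite oner_eq0.
apply: uv; rewrite -!L1_piZ -L1_piD -L1_pi0; apply/L1_eqP.
apply: filterS fa => w fw.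
rewrite bochner_valD !bochner_valZ fw scale0r addr0 scale1r /cutoff.
by case: ifP => // _; apply/eqP; rewrite -oppr_eq0; apply/eqP.
Qed.

End dimension.

(** * Application to vector-valued integrable functions *)

Theorem mainTheorem11 (R : realType) (k : scalar_kind)
    (d : measure_display) (Omega : measurableType d)
    (mu : {measure set Omega -> \bar R})
    (E : completeNormedModType (scalar_field R k))
    (E_neq0 : exists e : E, e != 0)
    (L1_dim : dim_gt1 (L1 mu (scalar_field R k)^o))
    (delta : R) (delta_gt0 : 0 < delta) (delta_le : delta <= 2^-1) :
  bpb_modulus (L1 mu E) delta = Num.sqrt (2 * delta) /\
  spherical_bpb_modulus (L1 mu E) delta = Num.sqrt (2 * delta).
Proof.
have [e e0] := E_neq0.
have [A [B [[mA A0 Aoo] [mB B0 Boo] AB]]] := dim_gt1_disjoint_pair L1_dim.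
pose fA := BochnerFun (simple_bochner (simple_integrable_cutoff_cst mA e Aoo)).
pose fB := BochnerFun (simple_bochner (simple_integrable_cutoff_cst mB e Boo)).
have neq0 (C : set Omega) (f : bochner_fun mu E) : measurable C ->
    (0 < mu C)%E -> (forall w, f w = cutoff C (cst e) w) ->
    \pi_(L1 mu E) f != 0.
  move=> mC C0 fE; apply/negP => /eqP; rewrite -L1_pi0 => /L1_eqP f0.
  suff : mu C = 0%E by move=> C00; move: C0; rewrite C00 ltxx.
  apply: measure_negligible => //; apply: negligibleS f0 => w Cw /=.
  by rewrite fE /cutoff mem_set//= => /eqP; rewrite (negbTE e0).
(* Restriction to [A] fixes the class of [e] times the indicator of [A] and kills that of [e] times
   the indicator of the disjoint set [B]. *)
apply: (@bpb_moduli_L_projection _ _ (L1 mu E) (L1_restr mA)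
  (\pi_(L1 mu E) fA) (\pi_(L1 mu E) fB)) => //.
- exact: L1_restr_L_projection.
- exact: (neq0 A).
- apply: L1_restr_pi; apply: aeW => w /=.
  by rewrite /cutoff; case: ifP.
- exact: (neq0 B).
- rewrite -L1_pi0; apply: L1_restr_pi; apply: aeW => w /=.
  rewrite /cutoff; case: ifPn => // wA; case: ifPn => // wB.
  suff : (A `&` B) w by rewrite AB.
  by split; rewrite -in_setE.
Qed.
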